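(* Under Nakagami-$m$ fading, in Solution II (the transmit antenna is $\hat i=\arg\max_{1\le i\le L_S}X_i$), the secrecy outage probability of user $F$, $$SOP_{F,II}=\Pr\left\{\log_2\left(1+\gamma_{FS_{\hat i}}^{x_F}\right)-\log_2\left(1+\gamma_{ES_{\hat i}}^{x_F}\right)<R_{s,F}\right\},$$ is approximately expressed as $$SOP_{F,II}\approx 1+\sum_{p=1}^{L_S}\sum_{\Delta_F=p}\sum_{m=0}^{a_E-1}\sum_{i=0}^{K}\Psi_{F,II}^{(1)}\,h_{F,II}\left[\frac{(v_i+1)u_F}{2}\right],$$ where $$\Psi_{F,II}^{(1)}=\frac{\pi u_F\,\Phi_F\,\alpha_F\,m_E^m\sqrt{1-v_i^2}}{m!\,2K\,\gamma_0^{\varphi_F}\gamma_E^m\lambda_{ES}^m},\qquad v_i=\cos\left[\frac{(2i-1)\pi}{2K}\right],\qquad u_F=\frac{1}{\alpha_N2^{R_{s,F}}}-1,$$ $$h_{F,II}(x)=\frac{A_{g_{x,F}}^{\varphi_F}A_x^{m-1}}{(\alpha_F-\alpha_Nx)^2}\,e^{-\frac{p\,m_FA_{g_{x,F}}}{\gamma_0\lambda_{FS}}-\frac{m_EA_x}{\gamma_E\lambda_{ES}}}\left(\frac{m_EA_x}{\gamma_E\lambda_{ES}}-m\right),\qquad g_{x,F}=2^{R_{s,F}}x+2^{R_{s,F}}-1,$$ and $K$ is a complexity-accuracy trade-off parameter (the order of the Gaussian-Chebyshev quadrature used to approximate the integral of $h_{F,II}$ over $[0,u_F]$).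
   Context: A source $S$ with $L_S$ antennas transmits, from one selected antenna, a superposition of messages $x_N$ and $x_F$ to a near user $N$ and a far user $F$ in the presence of a passive eavesdropper $E$; these have $L_N,L_F,L_E$ antennas and use maximal ratio combining. For $U\in\{N,F,E\}$, $h_{U_jS_i}$ is the channel coefficient from source antenna $i$ to antenna $j$ of $U$. The channels are mutually independent and identically distributed Nakagami-$m$ fading channels with parameter $m_U$ and mean power $\Omega_U$; with distance $d_{US}$ and path-loss exponent $\theta_{US}$, put $\lambda_{US}=\Omega_U/d_{US}^{\theta_{US}}$ and $a_U=m_UL_U$. Let $X_i=\|{\bf h}_{FS_i}\|^2=\sum_{j=1}^{L_F}|h_{F_jS_i}|^2$, $Y_i=\|{\bf h}_{NS_i}\|^2=\sum_{j=1}^{L_N}|h_{N_jS_i}|^2$, $Z_i=\|{\bf h}_{ES_i}\|^2=\sum_{j=1}^{L_E}|h_{E_jS_i}|^2$. Following the principle of non-orthogonal multiple access (NOMA), it is assumed that $\|{\bf h}_{NS_i}\|^2>\|{\bf h}_{FS_i}\|^2$ and that the power allocation coefficients satisfy $\alpha_F>\alpha_N>0$, $\alpha_F+\alpha_N=1$. The sum over $\Delta_F=p$ runs over all tuples $(\delta_{F,0},\dots,\delta_{F,a_F-1})$ of non-negative integers with $\Delta_F=\sum_{q=0}^{a_F-1}\delta_{F,q}=p$; for such a tuple $\varphi_F=\sum_{q=0}^{a_F-1}q\,\delta_{F,q}$ and $$\Phi_F=\binom{L_S}{p}(-1)^p\binom{p}{\delta_{F,0},\dots,\delta_{F,a_F-1}}\prod_{q=0}^{a_F-1}\left(\frac{m_F^q}{q!\lambda_{FS}^q}\right)^{\delta_{F,q}}$$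 (with a multinomial coefficient). In Solution II the distributions of $X_{\hat i}$ and $Z_{\hat i}$ are taken to be $F_{X_{\hat i}}(x)=1+\sum_{p=1}^{L_S}\sum_{\Delta_F=p}\Phi_Fx^{\varphi_F}e^{-p\,m_Fx/\lambda_{FS}}$ and $F_{Z_{\hat i}}(x)=1-\sum_{k=0}^{a_E-1}\frac{m_E^k}{k!\lambda_{ES}^k}x^ke^{-m_Ex/\lambda_{ES}}$. $\gamma_0$ and $\gamma_E$ are the average transmit SNRs associated with the legitimate users and with $E$, $R_{s,F}$ is the secrecy rate threshold at $F$, and $A_x=\frac{x}{\alpha_F-\alpha_Nx}$. The signal-to-interference-and-noise ratios for detecting $x_F$ at $F$ and $E$ when antenna $i$ transmits are $$\gamma_{FS_i}^{x_F}=\frac{\alpha_F\gamma_0X_i}{\alpha_N\gamma_0X_i+1},\qquad \gamma_{ES_i}^{x_F}=\frac{\alpha_F\gamma_EZ_i}{\alpha_N\gamma_EZ_i+1}.$$ In the sums, the last index $i$ is a quadrature node index.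
   Formalization: Assumes R_{s,F} ≥ 0 and u_F ≥ 0 (otherwise the quadrature interval meets poles and the formula fails), and takes the mean power of each channel coefficient to be λ_US, path loss included, as the stated distributions require; ≈ is read as convergence as K→∞. *)

(* Defs.v *)
From HB Require Import structures.
From mathcomp Require Import all_boot all_order all_algebra.
From mathcomp Require Import all_classical all_reals all_analysis.

Set Implicit Arguments.
Unset Strict Implicit.
Unset Printing Implicit Defensive.

Import Order.TTheory GRing.Theory Num.Theory.
Import numFieldNormedType.Exports.

Local Open Scope classical_set_scope.
Local Open Scope ring_scope.

Variant user := Near | Far | Eve.

Definition bool_of_user (U : user) : option bool :=
  match U with Near => Some true | Far => Some false | Eve => None end.

Definition user_of_bool (b : option bool) : user :=
  match b with Some true => Near | Some false => Far | None => Eve end.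

Lemma bool_of_userK : cancel bool_of_user user_of_bool.
Proof. by case. Qed.

HB.instance Definition _ := Finite.copy user (can_type bool_of_userK).

(* The index family is finite and some of the B k may be setT, so the product
   rule over the whole family contains the rule for every subfamily. *)
Definition mutually_independent d (T : measurableType d) (R : realType)
    (P : probability T R) d' (S : measurableType d') (I : finType)
    (X : I -> T -> S) : Prop :=
  forall B : I -> set S, (forall k, measurable (B k)) ->
    P (\bigcap_k (X k @^-1` B k)) = (\prod_k P (X k @^-1` B k))%E.

Section Nakagami.
Context {R : realType}.
Implicit Types (s m Omega r : R) (z : R * R).

Definition Gamma s : R :=
  \int[lebesgue_measure]_(t in `]0%R, +oo[) (t `^ (s - 1) * expR (- t)).

Definition nakagami_pdf m Omega r : R :=
  if 0 <= r then
    2 * m `^ m / (Gamma m * Omega `^ m) * r `^ (2 * m - 1)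
      * expR (- (m * r ^+ 2 / Omega))
  else 0.

(* A complex channel coefficient is encoded as (real part, imaginary part);
   the library norm on R * R is the maximum norm, not the modulus. *)
Definition modulus z : R := Num.sqrt (z.1 ^+ 2 + z.2 ^+ 2).

(* Only the modulus of a Nakagami-m coefficient is prescribed; its phase is
   arbitrary. Omega is the mean power, the expectation of |h|^2. *)
Definition nakagami d (T : measurableType d) (P : probability T R)
    (h : T -> R * R) m Omega : Prop :=
  forall B : set R, measurable B ->
    P [set w | B (modulus (h w))] =
    (\int[lebesgue_measure]_(r in B) (nakagami_pdf m Omega r)%:E)%E.

End Nakagami.

Section System.
Context {R : realType}.

Definition log2 (x : R) : R := ln x / ln 2.

Definition channel_gain (T : Type) (LS LU : nat)
    (h : 'I_LU -> 'I_LS -> T -> R * R) (i : 'I_LS) (w : T) : R :=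
  \sum_(j < LU) modulus (h j i w) ^+ 2.

Definition best_antenna (LS : nat) (LS_gt0 : (0 < LS)%N) (x : 'I_LS -> R) :
    'I_LS :=
  [arg max_(i > Ordinal LS_gt0) x i]%O.

(* The receiver treats the near user's message as noise. The usual ordering
   of the near and far gains serves only to justify this decoding order; it is
   never imposed below, as an almost sure ordering is incompatible with
   independent Nakagami channels. *)
Definition sinr_xF (alphaN alphaF gamma gain : R) : R :=
  alphaF * gamma * gain / (alphaN * gamma * gain + 1).

(* For a tuple of sum p every entry is at most p, hence the finite type. *)
Definition tuples (a p : nat) : {set {ffun 'I_a -> 'I_p.+1}} :=
  [set delta : {ffun 'I_a -> 'I_p.+1} | (\sum_(q < a) delta q)%N == p].

Definition varphi (a p : nat) (delta : {ffun 'I_a -> 'I_p.+1}) : nat :=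
  (\sum_(q < a) q * delta q)%N.

Definition Phi (LS a : nat) (mF lambdaF : R) (p : nat)
    (delta : {ffun 'I_a -> 'I_p.+1}) : R :=
  'C(LS, p)%:R * (-1) ^+ p
  * (p`!%:R / \prod_(q < a) (delta q)`!%:R)
  * \prod_(q < a) (mF ^+ q / (q`!%:R * lambdaF ^+ q)) ^+ delta q.

Definition cdf_X_best (LS aF : nat) (mF lambdaF x : R) : R :=
  1 + \sum_(1 <= p < LS.+1) \sum_(delta in tuples aF p)
        Phi LS mF lambdaF delta * x ^+ varphi delta
        * expR (- (p%:R * mF * x / lambdaF)).

Definition cdf_Z_best (aE : nat) (mE lambdaE x : R) : R :=
  1 - \sum_(k < aE) mE ^+ k / (k`!%:R * lambdaE ^+ k) * x ^+ k
        * expR (- (mE * x / lambdaE)).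

Definition A_ (alphaN alphaF x : R) : R := x / (alphaF - alphaN * x).

Definition g_ (RsF x : R) : R := 2 `^ RsF * x + 2 `^ RsF - 1.

Definition u_ (alphaN RsF : R) : R := 1 / (alphaN * 2 `^ RsF) - 1.

Definition v_ (K i : nat) : R := cos ((2 * i%:R - 1) * pi / (2 * K%:R)).

(* The exponent k - 1 is an integer: it is -1 for k = 0. *)
Definition h_FII (alphaN alphaF gamma0 gammaE RsF mF mE lambdaF lambdaE : R)
    (p phi k : nat) (x : R) : R :=
  let Ax := A_ alphaN alphaF x in
  let Ag := A_ alphaN alphaF (g_ RsF x) in
  Ag ^+ phi * Ax ^ (k%:Z - 1) / (alphaF - alphaN * x) ^+ 2
  * expR (- (p%:R * mF * Ag / (gamma0 * lambdaF))
          - mE * Ax / (gammaE * lambdaE))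
  * (mE * Ax / (gammaE * lambdaE) - k%:R).

Definition Psi_FII (LS aF : nat)
    (alphaN alphaF gamma0 gammaE RsF mF mE lambdaF lambdaE : R)
    (K p : nat) (delta : {ffun 'I_aF -> 'I_p.+1}) (k i : nat) : R :=
  pi * u_ alphaN RsF * Phi LS mF lambdaF delta * alphaF * mE ^+ k
    * Num.sqrt (1 - v_ K i ^+ 2)
  / (k`!%:R * (2 * K%:R) * gamma0 ^+ varphi delta * gammaE ^+ k
     * lambdaE ^+ k).

(* The quadrature index starts at 0, so that the node v_ K 0 = v_ K 1 occurs
   twice; the extra term vanishes as K grows. *)
Definition SOP_FII_approx (LS aF aE : nat)
    (alphaN alphaF gamma0 gammaE RsF mF mE lambdaF lambdaE : R)
    (K : nat) : R :=
  1 + \sum_(1 <= p < LS.+1) \sum_(delta in tuples aF p)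
      \sum_(0 <= k < aE) \sum_(0 <= i < K.+1)
        Psi_FII LS alphaN alphaF gamma0 gammaE RsF mF mE lambdaF lambdaE
          K delta k i
        * h_FII alphaN alphaF gamma0 gammaE RsF mF mE lambdaF lambdaE
            p (varphi delta) k ((v_ K i + 1) * u_ alphaN RsF / 2).

End System.

(* Main.v *)
(* The event "no secrecy outage" reads g(SE) <= SF, where SF and SE are the SINRs
   at the far user and at the eavesdropper for the selected antenna, and
   g(y) = 2^R y + 2^R - 1. These two are independent: the selection and SF depend
   on the far channels only, and the law of the eavesdropper's gain does not
   depend on the antenna. Put y(t) = (cos t + 1) u / 2 for t in [0, pi]. For s <= t
   the probability of {g(SE) <= SF, y(t) < SE <= y(s)} lies between
   P(y(t) < SE <= y(s)) times P(SF > g(y(s))) and the same factor times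
   P(SF > g(y(t))), so the probability of no outage is the Stieltjes integral of
   the monotone function t |-> P(SF > g(y(t))) against the differentiable function
   t |-> P(SE > y(t)). The Gauss-Chebyshev sum is its midpoint sum in the
   variable t; the node with index 0 repeats the node with index 1 and
   contributes O(1 / K). *)
Require Import Defs.
From HB Require Import structures.
From mathcomp Require Import all_boot all_order all_algebra.
From mathcomp Require Import all_classical all_reals all_analysis.
From mathcomp Require Import ring lra.

Import Order.TTheory GRing.Theory Num.Theory.
Import numFieldNormedType.Exports.

Local Open Scope classical_set_scope.
Local Open Scope ring_scope.

Set Implicit Arguments.
Unset Strict Implicit.

(** * Midpoint sums for Stieltjes integrals *)

(** Compactness of [[a, b]] in its near-covering form makes one [d] work around every [x]; [y] may
    leave the interval, since the local moduli come from continuity on the whole line. *)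
Lemma heine_cantor (R : realType) (f : R -> R) (a b e : R) :
  continuous f -> 0 < e ->
  exists2 d, 0 < d & forall x y, x \in `[a, b] ->
    `|x - y| < d -> `|f x - f y| < e.
Proof.
move=> cf e0.
have /compact_near_coveringP cab := @segment_compact R a b.
have [d /= d0 dP] : \forall d \near (0 : R)^'+, `[a, b] `<=`
    (fun d x => forall y, `|x - y| < d -> `|f x - f y| < e) d.
  apply: cab => x _.
  have e2 : 0 < e / 2 by rewrite divr_gt0.
  have /cvgrPdist_lt/(_ _ e2) [r /= r0 rP] := cf x.
  exists (ball x (r / 2), [set d | d < r / 2]) => /=.
    split; first by apply: nbhsx_ballx; rewrite divr_gt0.
    exists (r / 2) => /=; first by rewrite divr_gt0.
    by move=> z /=; rewrite sub0r normrN => /ltr_normlW.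
  move=> [x' d] /= [xx' dr] y yd; rewrite /ball/= in xx'.
  have h1 : `|f x - f x'| < e / 2 by apply: rP; rewrite /ball/=; lra.
  have h2 : `|f x - f y| < e / 2.
    apply: rP; rewrite /ball/=.
    by have := ler_distD x' x y; lra.
  by have := ler_distD (f x) (f x') (f y); rewrite (distrC (f x') (f x)); lra.
exists (d / 2); first by rewrite divr_gt0.
move=> x y xab; apply: (dP (d / 2)) => //=; last by rewrite divr_gt0.
by rewrite sub0r normrN gtr0_norm ?divr_gt0//; lra.
Qed.

Section stieltjes_midpoint.
Variables (R : realType) (b : R) (F N psi q : R -> R).
Hypotheses (b_gt0 : 0 < b) (q_continuous : continuous q).
Hypothesis F_derive : forall t : R, 0 < t <= b -> is_derive t 1 F (q t).
Hypothesis psi01 : forall t : R, 0 <= psi t <= 1.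
Hypothesis psi_nd : forall s t : R, 0 < s -> s <= t -> t <= b -> psi s <= psi t.
Hypothesis N_ge : forall s t : R, 0 < s -> s <= t -> t <= b ->
  (F t - F s) * psi s <= N t - N s.
Hypothesis N_le : forall s t : R, 0 < s -> s <= t -> t <= b ->
  N t - N s <= (F t - F s) * psi t.
Hypothesis N_small : N t @[t --> 0^'+] --> 0.

(** The mean value theorem turns [F t - F s] into [(t - s) * q c], so [N_le] and [N_ge] enclose the
    increment of [N]. Replacing [q c] by [q x] costs [e] because [psi] is at most 1; replacing
    [psi s] or [psi t] by [psi x] costs [M] times the oscillation of [psi]. *)
Lemma stieltjes_cell (M e s t x : R) : 0 < s -> s < t -> t <= b ->
    s <= x <= t -> (forall y, s <= y <= t -> `|q y| <= M) ->
    (forall y, s <= y <= t -> `|q y - q x| <= e) ->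
  `|N t - N s - (t - s) * (q x * psi x)| <=
    (t - s) * (M * (psi t - psi s) + e).
Proof.
move=> s0 st tb /andP[sx xt] qM qe.
have [||c cst FE] := @MVT _ F q s t st.
- move=> y; rewrite in_itv/= => /andP[sy yt]; apply: F_derive; lra.
- apply: derivable_within_continuous => y; rewrite in_itv/= => /andP[sy yt].
  have y0b : 0 < y <= b by lra.
  by have [] := F_derive y0b.
have /andP[sc ct] : s <= c <= t by move: cst; rewrite in_itv/= => /andP[]; lra.
have := N_ge s0 (ltW st) tb; have := N_le s0 (ltW st) tb; rewrite FE.
set D := N t - N s => D1 D2.
have qcM := qM c; have qce := qe c.
have {qcM} : `|q c| <= M by apply: qcM; rewrite sc.
have {qce} : `|q c - q x| <= e by apply: qce; rewrite sc.
rewrite !ler_norml => /andP[e1 e2] /andP[M1 M2].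
have p1 := psi_nd s0 sx (le_trans xt tb).
have p2 := psi_nd (lt_le_trans s0 sx) xt tb.
have /andP[p3 p4] := psi01 x; have /andP[p5 p6] := psi01 s.
have h0 : 0 < t - s by rewrite subr_gt0.
rewrite -(ler_pM2l h0) in e1; rewrite -(ler_pM2l h0) in e2.
set h := t - s in h0 e1 e2 *.
have E1 : (q c - q x) * psi x <= e by nra.
have E2 : - e <= (q c - q x) * psi x by nra.
have A1 : q c * (psi t - psi x) <= M * (psi t - psi s) by nra.
have A2 : - (M * (psi t - psi s)) <= q c * (psi s - psi x) by nra.
apply/andP; split.
  have : q c * psi s - q x * psi x >= - (M * (psi t - psi s) + e) by lra.
  by rewrite -(ler_pM2l h0); move: D2; rewrite -/h; lra.
have : q c * psi t - q x * psi x <= (M * (psi t - psi s) + e) by lra.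
by rewrite -(ler_pM2l h0); move: D1; rewrite -/h; lra.
Qed.

(* N is the Stieltjes integral of psi against F; only monotonicity of psi is
   needed, since the oscillations of psi over the cells telescope. *)
Lemma stieltjes_midpoint_cvg :
  b / K%:R * (\sum_(1 <= i < K.+1)
    q ((2 * i%:R - 1) * b / (2 * K%:R)) * psi ((2 * i%:R - 1) * b / (2 * K%:R)))
  @[K --> \oo] --> N b.
Proof.
have [M M0 qM] : exists2 M, 0 < M & forall t, 0 <= t <= b -> `|q t| <= M.
  have [|c _ cP] := @EVT_max _ (fun t => `|q t|) 0 b (ltW b_gt0).
    apply: continuous_subspaceT => t.
    by apply: continuous_comp; [exact: q_continuous|exact: norm_continuous].
  exists (`|q c| + 1); first by rewrite ltr_wpDl.
  by move=> t tb; rewrite (le_trans (cP t _)) ?lerDl// in_itv.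
apply/cvgrPdist_le => /= e0 e0_gt0.
(* The errors to absorb are [e] and [e / 2] on the first cell, and [e / 2 + b * e] on the others. *)
pose e := e0 / (b + 2).
have b2_gt0 : 0 < b + 2 by rewrite addr_gt0.
have e_gt0 : 0 < e by rewrite divr_gt0.
have [d d0 dP] := @heine_cantor _ q 0 b e q_continuous e_gt0.
move/cvgrPdist_lt: N_small => /(_ e e_gt0) [r /= r0 rP].
(* In order: uniform continuity of [q], smallness of [N] near 0, and [h * M <= e / 2] for the mesh
   [h]. *)
pose w := Num.min d (Num.min r (e / (2 * M))).
have w0 : 0 < w by rewrite !lt_min d0 r0 divr_gt0// mulr_gt0.
near=> K.
have K0 : 0 < K%:R :> R by near: K; exact: nbhs_infty_gtr.
have K_gt0 : (0 < K)%N by rewrite -(ltr_nat R).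
pose h := b / K%:R.
have h0 : 0 < h by rewrite divr_gt0.
have : h < w.
  rewrite /h ltr_pdivrMr// mulrC -ltr_pdivrMr//.
  by near: K; exact: nbhs_infty_gtr.
rewrite !lt_min => /and3P[hd hr hM].
have hKb : K%:R * h = b by rewrite /h mulrC divfK// gt_eqF.
pose t (i : nat) := i%:R * h.
have tS i : t i.+1 = t i + h by rewrite /t -natr1 mulrDl mul1r.
(* The sum is indexed from 1, so node [i.+1] is the midpoint of the cell from [t i] to [t i.+1]. *)
have tE (i : nat) : (2 * i.+1%:R - 1) * b / (2 * K%:R) = t i + h / 2.
  by rewrite /t /h -natr1; field; rewrite gt_eqF.
have t_gt0 i : (0 < i)%N -> 0 < t i by move=> i0; rewrite mulr_gt0// ltr0n.
have t_le i : (i <= K)%N -> t i <= b.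
  by move=> iK; rewrite -hKb ler_wpM2r ?ler_nat// ltW.
(* Telescoping starts at [t 1]: on the cell touching 0, where [F] need not be derivable, [N_small]
   and the bound on [q] are used instead. *)
have NE : N b = N (t 1%N) + \sum_(1 <= i < K) (N (t i.+1) - N (t i)).
  by rewrite (telescope_sumr (N \o t))//= /t hKb addrC subrK.
have psiE : \sum_(1 <= i < K) (psi (t i.+1) - psi (t i)) <= 1.
  rewrite (telescope_sumr (psi \o t))//=.
  by have := psi01 (t K); have := psi01 (t 1%N); lra.
have SE (f : nat -> R) :
    \sum_(1 <= i < K.+1) f i = f 1%N + \sum_(1 <= i < K) f i.+1.
  by rewrite big_ltn ?ltnS// big_add1.
rewrite NE mulr_sumr SE -/h tE /t mul0r add0r mul1r -/t.
under [X in _ - (_ + X)]eq_bigr do rewrite tE.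
have N1 : `|N h| <= e.
  have := rP h; rewrite /= sub0r normrN gtr0_norm// sub0r normrN => /(_ hr h0).
  exact: ltW.
have q1 : `|h * (q (h / 2) * psi (h / 2))| <= e / 2.
  rewrite normrM gtr0_norm// normrM.
  have hb : h <= b by rewrite -(mul1r h) (t_le 1%N).
  have := qM (h / 2); have /andP[p0 p1] := psi01 (h / 2).
  rewrite (ger0_norm p0) => /(_ _) qq.
  have {}qq : `|q (h / 2)| <= M by apply: qq; lra.
  have : `|q (h / 2)| * psi (h / 2) <= M by have := normr_ge0 (q (h/2)); nra.
  rewrite -(ler_pM2l h0) => /le_trans; apply.
  move: hM; rewrite ltr_pdivlMr ?mulr_gt0//; lra.
have cells : `|\sum_(1 <= i < K) (N (t i.+1) - N (t i))
    - \sum_(1 <= i < K) h * (q (t i + h / 2) * psi (t i + h / 2))|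
    <= e / 2 + b * e.
  rewrite -sumrB (le_trans (ler_norm_sum _ _ _))//.
  apply: (@le_trans _ _ (\sum_(1 <= i < K)
      h * (M * (psi (t i.+1) - psi (t i)) + e))).
    rewrite big_nat [leRHS]big_nat; apply: ler_sum => i /andP[i1 iK].
    have hE : t i.+1 - t i = h by rewrite tS addrC addKr.
    have ti := t_gt0 i i1; have tiK := t_le i.+1 iK.
    rewrite tS in hE tiK *.
    have := @stieltjes_cell M e (t i) (t i + h) (t i + h / 2).
    rewrite hE; apply => //; try lra.
    - by move=> y yti; apply: qM; lra.
    - move=> y yti; apply/ltW/dP; first by rewrite in_itv/=; lra.
      rewrite (@le_lt_trans _ _ h)// ler_norml; lra.
  (* The first part is at most [h * M <= e / 2]; the second has [K - 1] summands [e], giving at most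
     [b * e]. *)
  rewrite -mulr_sumr big_split/= -mulr_sumr mulrDr lerD//.
    have : M * \sum_(1 <= i < K) (psi (t i.+1) - psi (t i)) <= M by nra.
    rewrite -(ler_pM2l h0) => /le_trans; apply.
    move: hM; rewrite ltr_pdivlMr ?mulr_gt0//; lra.
  rewrite sumr_const_nat -mulr_natr mulrCA mulrC ler_pM2r//.
  rewrite -hKb mulrC ler_pM2r// ler_nat; exact: leq_subr.
rewrite (_ : _ - _ = N h - h * (q (h / 2) * psi (h / 2)) +
  (\sum_(1 <= i < K) (N (t i.+1) - N (t i))
    - \sum_(1 <= i < K) h * (q (t i + h / 2) * psi (t i + h / 2)))); last first.
  by rewrite opprD addrACA.
have eE : e0 = e * (b + 2) by rewrite /e divfK// gt_eqF.
rewrite eE.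
have := ler_normB (N h) (h * (q (h / 2) * psi (h / 2))).
have := ler_normD (N h - h * (q (h / 2) * psi (h / 2)))
  (\sum_(1 <= i < K) (N (t i.+1) - N (t i))
    - \sum_(1 <= i < K) h * (q (t i + h / 2) * psi (t i + h / 2))).
by lra.
Unshelve. all: by end_near.
Qed.

End stieltjes_midpoint.

(** * Independence and laws of vector-valued maps *)

Section rectangles.
Context {I : finType} {R : realType}.

Definition rectangle (B : I -> set R) : set (I -> R) :=
  [set f | forall k, B k (f k)].

Definition rectangles : set (set (I -> R)) :=
  [set rectangle B | B in [set B | forall k, measurable (B k)]].

Lemma rectangle_preimage T (X : I -> T -> R) (B : I -> set R) :
  [set w | rectangle B (X^~ w)] = \bigcap_k (X k @^-1` B k).
Proof.
by apply/seteqP; split=> [w Bw k _|w Bw k]; [exact: Bw|exact: (Bw k Logic.I)].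
Qed.

Lemma setI_closed_rectangles : setI_closed rectangles.
Proof.
move=> _ _ [B mB <-] [C mC <-]; exists (fun k => B k `&` C k).
  by move=> k; exact: measurableI.
by apply/seteqP; split=> [f BC|f [Bf Cf] k]; [split=> k; case: (BC k)|split].
Qed.

(** The product sigma-algebra on [I -> R], presented by the pi-system of measurable boxes so that
    Dynkin's uniqueness theorem applies. *)
Definition coordinates := g_sigma_algebraType rectangles.

Lemma rectangle_measurable (B : I -> set R) :
  (forall k, measurable (B k)) -> measurable (rectangle B : set coordinates).
Proof. by move=> mB; apply: sub_sigma_algebra; exists B. Qed.

Lemma measurable_coordinate (k : I) :
  measurable_fun setT (fun f : coordinates => f k).
Proof.
move=> _ B mB; rewrite setTI.
rewrite (_ : _ @^-1` _ = rectangle (fun k' => if k' == k then B else setT)).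
  by apply: rectangle_measurable => k'; case: ifP.
apply/seteqP; split=> [f /= Bf k'|f /(_ k)]; last by rewrite eqxx.
by case: eqP => // ->.
Qed.

Lemma measurable_coordinates d (T : measurableType d) (X : I -> T -> R) :
  (forall k, measurable_fun setT (X k)) ->
  measurable_fun setT (fun w => X^~ w : coordinates).
Proof.
move=> mX; apply: (@measurability _ _ T coordinates setT _ rectangles) => //.
move=> _ [_ [B mB <-] <-]; rewrite setTI.
rewrite [_ @^-1` _](rectangle_preimage X B).
apply: fin_bigcap_measurable; first exact: finite_finset.
by move=> k _; rewrite -[X in measurable X]setTI; exact: mX.
Qed.

Lemma rectangles_measure_unique (m1 m2 : {measure set coordinates -> \bar R}) :
  (m1 setT < +oo)%E ->
  (forall B, (forall k, measurable (B k)) ->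
    m1 (rectangle B) = m2 (rectangle B)) ->
  forall D, measurable D -> m1 D = m2 D.
Proof.
move=> m1T m12 D mD.
apply: (@g_sigma_algebra_measure_unique _ R coordinates rectangles _
  (fun=> setT)) => //.
- by move=> _ [B mB <-]; exact: rectangle_measurable.
- by move=> _; exists (fun=> setT) => //; apply/seteqP; split.
- by apply/seteqP; split=> // x _; exists 0%N.
- exact: setI_closed_rectangles.
- by move=> _ [B mB <-]; exact: m12.
Qed.

Variables (d : measure_display) (T : measurableType d).

(** Uniqueness on boxes, applied to the image measures. Two measures and two families are allowed so
    that it serves both for equal laws (one measure, two families) and for independence of an event
    (a restricted and a scaled measure, one family). *)
Lemma rectangle_events_unique (m1 m2 : {measure set T -> \bar R})
    (X1 X2 : I -> T -> R) :
  (forall k, measurable_fun setT (X1 k)) ->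
  (forall k, measurable_fun setT (X2 k)) -> (m1 setT < +oo)%E ->
  (forall B, (forall k, measurable (B k)) ->
    m1 (\bigcap_k (X1 k @^-1` B k)) = m2 (\bigcap_k (X2 k @^-1` B k))) ->
  forall D : set coordinates, measurable D ->
    m1 [set w | D (X1^~ w)] = m2 [set w | D (X2^~ w)].
Proof.
move=> mX1 mX2 m1T m12.
pose pm1 : {measure set coordinates -> \bar R} :=
  measure_function_pushforward__canonical__measure_function_Measure m1
    (measurable_coordinates mX1).
pose pm2 : {measure set coordinates -> \bar R} :=
  measure_function_pushforward__canonical__measure_function_Measure m2
    (measurable_coordinates mX2).
apply: (@rectangles_measure_unique pm1 pm2) => // B mB.
have := rectangle_preimage X1 B; have := rectangle_preimage X2 B.
by rewrite /pm1 /pm2 /= /pushforward /preimage => -> ->; exact: m12.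
Qed.

(** As functions of the event [D], both sides are finite measures: [P] restricted to [C] and [P]
    scaled by the number [P C]. They agree on boxes. *)
Lemma rectangles_independent (P : probability T R) (X : I -> T -> R)
    (C : set T) :
  (forall k, measurable_fun setT (X k)) -> measurable C ->
  (forall B, (forall k, measurable (B k)) ->
    P ((\bigcap_k (X k @^-1` B k)) `&` C) =
    (P (\bigcap_k (X k @^-1` B k)) * P C)%E) ->
  forall D : set coordinates, measurable D ->
    P ([set w | D (X^~ w)] `&` C) = (P [set w | D (X^~ w)] * P C)%E.
Proof.
move=> mX mC XC D mD.
have PC0 : 0 <= fine (P C) by rewrite fine_ge0.
have PCE : (fine (P C))%:E = P C by rewrite fineK// fin_num_measure.
pose m1 : {measure set T -> \bar R} := mrestr P mC.
pose m2 : {measure set T -> \bar R} := mscale (NngNum PC0) P.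
rewrite muleC -PCE; apply: (@rectangle_events_unique m1 m2) => //.
  by rewrite /m1 /= /mrestr setTI (le_lt_trans (probability_le1 _ mC))// ltry.
by move=> B mB; rewrite /m1 /m2 /= /mrestr /mscale/= PCE XC// muleC.
Qed.

End rectangles.

(** Grouping constraints by the fibres of [phi] turns an event about a subfamily into one about the
    whole family; an index outside the image receives an empty intersection, that is [setT]. *)
Lemma bigcap_preimage_fibers (T S I J : Type) (X : I -> T -> S) (phi : J -> I)
    (B : J -> set S) :
  \bigcap_j (X (phi j) @^-1` B j) =
  \bigcap_k (X k @^-1` \bigcap_(j in [set j | phi j = k]) B j).
Proof.
apply/seteqP; split=> [w Bw k _ j /= <-|w Bw j _]; first exact: Bw.
exact: (Bw (phi j)).
Qed.

(** * Images and subfamilies of independent families *)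

Section independent_families.
Context d (T : measurableType d) (R : realType) (P : probability T R).
Context d' (S : measurableType d') (I : finType) (X : I -> T -> S).
Hypothesis X_indep : mutually_independent P X.

Lemma mutually_independent_comp d2 (S2 : measurableType d2) (f : S -> S2) :
  measurable_fun setT f -> mutually_independent P (fun k => f \o X k).
Proof.
move=> mf B mB.
have mfB k : measurable (f @^-1` B k).
  by rewrite -[X in measurable X]setTI; exact: mf.
rewrite (eq_bigcapr (G := fun k => X k @^-1` (f @^-1` B k))); last first.
  by move=> k _; rewrite comp_preimage.
rewrite (X_indep mfB); apply: eq_bigr => k _.
by rewrite comp_preimage.
Qed.

(** At each index one of the two sets is everything, so the factor of the intersection is the
    product of the two factors. *)
Lemma mutually_independent_split (B C : I -> set S) :
  (forall k, measurable (B k)) -> (forall k, measurable (C k)) ->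
  (forall k, B k = setT \/ C k = setT) ->
  P ((\bigcap_k (X k @^-1` B k)) `&` (\bigcap_k (X k @^-1` C k))) =
  (P (\bigcap_k (X k @^-1` B k)) * P (\bigcap_k (X k @^-1` C k)))%E.
Proof.
move=> mB mC BC; rewrite -bigcapI.
rewrite (_ : (\bigcap_k _) = \bigcap_k (X k @^-1` (B k `&` C k)))//.
rewrite !X_indep//; last by move=> k; exact: measurableI.
rewrite -big_split; apply: eq_bigr => k _ /=.
by case: (BC k) => ->; rewrite preimage_setT probability_setT ?mul1e ?mule1
  ?setTI ?setIT.
Qed.

Variables (J : finType) (phi : J -> I).

Lemma mutually_independent_sub : injective phi ->
  mutually_independent P (fun j => X (phi j)).
Proof.
move=> phi_inj B mB; rewrite bigcap_preimage_fibers X_indep; last first.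
  by move=> k; apply: fin_bigcap_measurable => //; exact: finite_finset.
rewrite (bigID (fun k => k \in [set phi j | j in J]%SET))/= [X in (_ * X)%E]big1.
  rewrite mule1 big_imset; last by move=> i j _ _; exact: phi_inj.
  apply: eq_bigr => j _; congr (P (_ @^-1` _)).
  by apply/seteqP; split=> [x /(_ j)|x Bx j' /phi_inj ->]//; exact.
move=> k kJ; rewrite (_ : bigcap _ _ = setT) ?preimage_setT
  ?probability_setT//.
apply/seteqP; split=> // x _ j /= jk; move/imsetP: kJ => [].
by exists j.
Qed.

End independent_families.

Lemma mutually_independent_disjoint d (T : measurableType d) (R : realType)
    (P : probability T R) d' (S : measurableType d') (I J1 J2 : finType)
    (X : I -> T -> S) (phi1 : J1 -> I) (phi2 : J2 -> I) :
  mutually_independent P X -> (forall i j, phi1 i <> phi2 j) ->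
  forall (B : J1 -> set S) (C : J2 -> set S),
  (forall k, measurable (B k)) -> (forall k, measurable (C k)) ->
  P ((\bigcap_j (X (phi1 j) @^-1` B j)) `&`
     (\bigcap_j (X (phi2 j) @^-1` C j))) =
  (P (\bigcap_j (X (phi1 j) @^-1` B j)) *
   P (\bigcap_j (X (phi2 j) @^-1` C j)))%E.
Proof.
move=> X_indep phi12 B C mB mC.
rewrite (bigcap_preimage_fibers _ phi1) (bigcap_preimage_fibers _ phi2).
apply: (mutually_independent_split X_indep) => k.
- by apply: fin_bigcap_measurable => //; exact: finite_finset.
- by apply: fin_bigcap_measurable => //; exact: finite_finset.
- have [[j jk]|nk] := pselect (exists j, phi1 j = k).
    right; apply/seteqP; split=> // x _ j' /= j'k.
    by have := phi12 j j'; rewrite jk j'k.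
  left; apply/seteqP; split=> // x _ j' /= j'k.
  by exfalso; apply: nk; exists j'.
Qed.

(** * The selected antenna *)

Lemma best_antenna_measurable d (T : measurableType d) (R : realType) (n : nat)
    (n_gt0 : (0 < n)%N) (x : 'I_n -> T -> R) (i : 'I_n) :
  (forall i, measurable_fun setT (x i)) ->
  measurable [set w | best_antenna n_gt0 (x^~ w) = i].
Proof.
move=> mx.
(* The maximiser depends on w only through a finite table of comparisons. *)
pose G (t : {ffun 'I_n * 'I_n -> bool}) : 'I_n :=
  odflt (Ordinal n_gt0) [pick i | [forall j, t (j, i)]].
have -> : [set w | best_antenna n_gt0 (x^~ w) = i] =
    \bigcup_(t in [set t | G t = i])
      \bigcap_p [set w | (x p.1 w <= x p.2 w) = t p].
  apply/seteqP; split=> [w /= <-|w [t /= <- tw]].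
    exists [ffun p => x p.1 w <= x p.2 w] => [|p _ /=]; last by rewrite ffunE.
    congr (odflt _ _); apply: eq_pick => j /=.
    by apply: eq_forallb => k; rewrite ffunE.
  congr (odflt _ _); apply: eq_pick => j /=.
  by apply: eq_forallb => k; have /= -> := tw (k, j) I.
apply: fin_bigcup_measurable; first exact: finite_finset.
move=> t _; apply: fin_bigcap_measurable; first exact: finite_finset.
move=> p _; have := measurable_realfun.measurable_fun_ler (mx p.1) (mx p.2).
by move=> /(_ measurableT [set t p] Logic.I); rewrite setTI.
Qed.

(** Split over the values of [s]: on [s = i] the event about [Z i] factors out, and its probability
    is the same for all [i], so it leaves the sum. The case [A' = setT] identifies this common value
    with the probability for the selected [Z]. *)
Lemma selected_independent d (T : measurableType d) (R : realType)
    (P : probability T R) (n : nat) (s : T -> 'I_n) (Z : 'I_n -> T -> R)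
    (A : set T) (B : set R) :
  (forall i, measurable (s @^-1` [set i])) ->
  (forall i, measurable_fun setT (Z i)) -> measurable A -> measurable B ->
  (forall i (A' : set T), A' = A \/ A' = setT ->
    P ((s @^-1` [set i] `&` A') `&` Z i @^-1` B) =
    (P (s @^-1` [set i] `&` A') * P (Z i @^-1` B))%E) ->
  (forall i j, P (Z i @^-1` B) = P (Z j @^-1` B)) ->
  P (A `&` [set w | B (Z (s w) w)]) = (P A * P [set w | B (Z (s w) w)])%E.
Proof.
move=> ms mZ mA mB sA Zid.
have PE (C : 'I_n -> set T) : (forall i, measurable (C i)) ->
    P [set w | C (s w) w] = (\sum_(i < n) P (s @^-1` [set i] `&` C i))%E.
  move=> mC; rewrite -measure_bigsetU_ord/=; last 2 first.
  - by move=> i; exact: measurableI.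
  - by move=> i j _ _ [w [[/= <- _] [/= <- _]]].
  rewrite -bigcup_pred; congr (P _); apply/seteqP; split=> w.
    by move=> Cw; exists (s w).
  by move=> [i _ [/= <-]].
have mZB i : measurable (Z i @^-1` B).
  by rewrite -[X in measurable X]setTI; exact: mZ.
have key A' : measurable A' -> A' = A \/ A' = setT -> forall j,
    P (A' `&` [set w | B (Z (s w) w)]) = (P A' * P (Z j @^-1` B))%E.
  move=> mA' A'E j.
  rewrite [_ `&` _](_ : _ = [set w | (A' `&` Z (s w) @^-1` B) w])//.
  rewrite (PE (fun i => A' `&` Z i @^-1` B)); last first.
    by move=> i; exact: measurableI.
  rewrite (_ : P A' = (\sum_(i < n) P (s @^-1` [set i] `&` A'))%E); last first.
    by rewrite -(PE (fun=> A')).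
  rewrite ge0_sume_distrl; last by move=> i _; exact: measure_ge0.
  by apply: eq_bigr => i _; rewrite setIA sA// (Zid i j).
(* The common value is read at some index [j]; without any index there is no sample point either. *)
have [[j]|n0] := pselect (inhabited 'I_n); last first.
  have A0 : A = set0.
    by apply/seteqP; split=> // w _; apply: n0; exact: (inhabits (s w)).
  by rewrite A0 set0I measure0 mul0e.
rewrite (key A mA (or_introl erefl) j).
have := key setT measurableT (or_intror erefl) j.
by rewrite setTI probability_setT mul1e => ->.
Qed.

Lemma measurable_selected d (T : measurableType d) (R : realType) (n : nat)
    (s : T -> 'I_n) (Z : 'I_n -> T -> R) :
  (forall i, measurable (s @^-1` [set i])) ->
  (forall i, measurable_fun setT (Z i)) ->
  measurable_fun setT (fun w => Z (s w) w).
Proof.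
move=> ms mZ _ B mB; rewrite setTI.
rewrite (_ : _ @^-1` B = \bigcup_i (s @^-1` [set i] `&` Z i @^-1` B)).
  apply: fin_bigcup_measurable; first exact: finite_finset.
  move=> i _; apply: measurableI => //.
  by rewrite -[X in measurable X]setTI; exact: mZ.
by apply/seteqP; split=> [w Bw|w [i _ [/= <-]]]//; exists (s w).
Qed.

Lemma measurable_modulus (R : realType) :
  measurable_fun setT (@modulus R).
Proof.
rewrite (_ : @modulus R = fun z => (z.1 ^+ 2 + z.2 ^+ 2) `^ 2^-1); last first.
  by apply/funext => z; rewrite powR12_sqrt// addr_ge0// sqr_ge0.
apply: (measurableT_comp (measurable_realfun.measurable_powR _)).
by apply: measurable_realfun.measurable_funD;
  apply: measurable_realfun.measurable_funX.
Qed.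

Lemma measurable_sum_squares d (T : measurableType d) (R : realType) (n : nat)
    (f : 'I_n -> T -> R) :
  (forall j, measurable_fun setT (f j)) ->
  measurable_fun setT (fun w => \sum_(j < n) f j w ^+ 2).
Proof.
move=> mf; apply: measurable_sum => j.
by apply: measurable_realfun.measurable_funX; exact: mf.
Qed.

(* Only the moduli of the coefficients are identically distributed, so the
   independence is first transported to the moduli. The gain of Eve at the
   selected antenna has the same law whatever the antenna is. *)
Lemma far_eve_independent (R : realType) d (T : measurableType d)
    (P : probability T R) (LS : nat) (LS_gt0 : (0 < LS)%N) (L : user -> nat)
    (m lambda : user -> R)
    (h : forall U : user, 'I_(L U) -> 'I_LS -> {RV P >-> (R * R)%type}) :
  (forall (U : user) (j : 'I_(L U)) (i : 'I_LS),
     nakagami P (h U j i) (m U) (lambda U)) ->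
  mutually_independent P
    (fun k : {U : user & ('I_(L U) * 'I_LS)%type} =>
       h (tag k) (tagged k).1 (tagged k).2 : T -> R * R) ->
  let X (i : 'I_LS) (w : T) := channel_gain (h Far) i w in
  let Z (i : 'I_LS) (w : T) := channel_gain (h Eve) i w in
  let ihat (w : T) := best_antenna LS_gt0 (fun i => X i w) in
  [/\ measurable_fun setT (fun w => X (ihat w) w),
      measurable_fun setT (fun w => Z (ihat w) w) &
      forall B C : set R, measurable B -> measurable C ->
        P ([set w | B (X (ihat w) w)] `&` [set w | C (Z (ihat w) w)]) =
        (P [set w | B (X (ihat w) w)] * P [set w | C (Z (ihat w) w)])%E].
Proof.
move=> h_nak h_indep X Z ihat.
pose I : finType := {U : user & ('I_(L U) * 'I_LS)%type}.
pose r (k : I) : T -> R := @modulus R \o h (tag k) (tagged k).1 (tagged k).2.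
have mr k : measurable_fun setT (r k).
  by apply: measurableT_comp => //; exact: measurable_modulus.
have r_indep : mutually_independent P r.
  exact: (mutually_independent_comp h_indep (@measurable_modulus R)).
pose phiF (p : 'I_(L Far) * 'I_LS) : I := existT _ Far p.
pose phiE (i : 'I_LS) (j : 'I_(L Eve)) : I := existT _ Eve (j, i).
pose gain (i : 'I_LS) (f : @coordinates ('I_(L Far) * 'I_LS)%type R) : R :=
  \sum_(j < L Far) f (j, i) ^+ 2.
have mgain i : measurable_fun setT (gain i).
  by apply: measurable_sum_squares => j; exact: measurable_coordinate.
have mX i : measurable_fun setT (X i).
  by apply: measurable_sum_squares => j; exact: (mr (phiF (j, i))).
have mZ i : measurable_fun setT (Z i).
  by apply: measurable_sum_squares => j; exact: (mr (phiE i j)).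
have mihat i : measurable (ihat @^-1` [set i]) by exact: best_antenna_measurable.
have mXihat : measurable_fun setT (fun w => X (ihat w) w).
  exact: measurable_selected.
have mZihat : measurable_fun setT (fun w => Z (ihat w) w).
  exact: measurable_selected.
split=> // B C mB mC.
have mE : measurable [set g : @coordinates 'I_(L Eve) R |
    C (\sum_(j < L Eve) g j ^+ 2)].
  rewrite -[X in measurable X]setTI.
  have : measurable_fun setT (fun g : @coordinates 'I_(L Eve) R =>
      \sum_(j < L Eve) g j ^+ 2).
    by apply: measurable_sum_squares => j; exact: measurable_coordinate.
  by apply.
apply: selected_independent => //.
- by rewrite -[X in measurable X]setTI; exact: mXihat.
- move=> i A' A'E.
  (* Selection and far gain are functions of the far moduli alone, so the event is the preimage of a
     measurable set of coordinates. *)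
  have [D mD DE] : exists2 D : set (@coordinates ('I_(L Far) * 'I_LS)%type R),
      measurable D & ihat @^-1` [set i] `&` A' =
        [set w | D (fun k => r (phiF k) w)].
    pose best (f : @coordinates ('I_(L Far) * 'I_LS)%type R) :=
      best_antenna LS_gt0 (fun i => gain i f).
    have mbest k : measurable (best @^-1` [set k]).
      exact: best_antenna_measurable.
    case: A'E => ->.
      exists (best @^-1` [set i] `&` [set f | B (gain (best f) f)]) => //.
      apply: measurableI => //; rewrite -[X in measurable X]setTI.
      by have := measurable_selected mbest mgain; exact.
    by exists (best @^-1` [set i]) => //; rewrite setIT.
  (* Two passes: [D] is reduced to boxes of far moduli; then, with such a box as the fixed event,
     the condition on Eve's gain is reduced to boxes. Boxes over disjoint indices are
     independent. *)
  rewrite DE; apply: rectangles_independent => //.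
  + by rewrite -[X in measurable X]setTI; exact: mZ.
  + move=> F mF; rewrite setIC [RHS]muleC.
    have -> : Z i @^-1` C = [set w |
        [set g : @coordinates 'I_(L Eve) R | C (\sum_(j < L Eve) g j ^+ 2)]
          (fun j => r (phiE i j) w)] by [].
    apply: rectangles_independent => //.
      apply: fin_bigcap_measurable; first exact: finite_finset.
      by move=> k _; rewrite -[X in measurable X]setTI; exact: mr.
    by move=> G mG; apply: (mutually_independent_disjoint r_indep).
- move=> i j.
  have Zi k : Z k @^-1` C = [set w |
        [set g : @coordinates 'I_(L Eve) R | C (\sum_(j < L Eve) g j ^+ 2)]
          (fun j => r (phiE k j) w)] by [].
  have phiE_inj k : injective (phiE k).
    move=> a b; rewrite /phiE => /eqP.
    by rewrite -tag_eqE /tag_eq /= tagged_asE xpair_eqE => /andP[/eqP].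
  (* At both antennas Eve's moduli are independent with the same Nakagami law, so boxes have equal
     probabilities. *)
  have rect F : (forall k, measurable (F k)) ->
      P (\bigcap_k (r (phiE i k) @^-1` F k)) =
      P (\bigcap_k (r (phiE j k) @^-1` F k)).
    move=> mF.
    rewrite (mutually_independent_sub r_indep (phiE_inj i) mF).
    rewrite (mutually_independent_sub r_indep (phiE_inj j) mF).
    apply: eq_bigr => k _.
    by rewrite /preimage /r /= !(h_nak Eve).
  rewrite !Zi; apply: (rectangle_events_unique _ _ _ rect) => //.
  by rewrite (le_lt_trans (probability_le1 _ _))// ltry.
Qed.

(** * Exponential polynomials and the Chebyshev parametrization *)

Section exponential_polynomial.
Context {R : realType}.
Implicit Types (p : {poly R}) (b x : R).

(** A class closed under differentiation that contains the tail and the density of a gamma law of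
    integer shape. *)
Definition exp_poly p b x : R := p.[x] * expR (- (b * x)).

Lemma is_derive_exp_poly p b x :
  is_derive x 1 (exp_poly p b) (exp_poly (p^`() - b *: p) b x).
Proof.
have dexp : is_derive x 1 (fun x => expR (- (b * x))) (expR (- (b * x)) * - b).
  apply: (is_derive1_comp (f := expR) (g := fun x => - (b * x))).
  by apply: is_derive_eq; rewrite /GRing.scale /=; ring.
apply: is_derive_eq.
rewrite /exp_poly hornerD hornerN hornerZ /GRing.scale /=; ring.
Qed.

Lemma continuous_exp_poly p b : continuous (exp_poly p b).
Proof.
move=> x; apply: differentiable_continuous; apply/derivable1_diffP.
by have [] := is_derive_exp_poly p b x.
Qed.

(** Monomial by monomial: x^i exp(-b x) is at most i! / b^i, because exp(b x) dominates its Taylor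
    term of order i. *)
Lemma exp_poly_bounded p b : 0 < b ->
  exists2 M : R, 0 <= M & forall x, 0 <= x -> `|exp_poly p b x| <= M.
Proof.
move=> b0.
have powE x i : 0 <= x -> x ^+ i * expR (- (b * x)) <= i`!%:R / b ^+ i.
  move=> x0; rewrite expRN ler_pdivrMr ?expR_gt0// mulrAC.
  rewrite ler_pdivlMr ?exprn_gt0// -exprMn (mulrC x).
  have bx0 : 0 <= b * x by rewrite mulr_ge0// ltW.
  case: i => [|i]; first by rewrite fact0 mul1r expr0 -expR0 ler_expR.
  rewrite -ler_pdivrMl ?ltr0n ?fact_gt0// (mulrC _^-1).
  by rewrite (le_trans _ (expR_ge1Dxn i bx0))// lerDr.
exists (\sum_(i < size p) `|p`_i| * (i`!%:R / b ^+ i)).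
  apply: sumr_ge0 => i _; rewrite mulr_ge0// divr_ge0// ?exprn_ge0// ltW//.
move=> x x0; rewrite /exp_poly horner_coef mulr_suml.
rewrite (le_trans (ler_norm_sum _ _ _))//; apply: ler_sum => i _.
rewrite -mulrA normrM ler_wpM2l//.
by rewrite ger0_norm ?powE// mulr_ge0 ?exprn_ge0// expR_ge0.
Qed.

End exponential_polynomial.

(** * The substitution y = (cos t + 1) u / 2 *)

Section chebyshev_parameter.
Context {R : realType}.
Variables (alphaN alphaF gamma u b : R) (p : {poly R}).
Hypotheses (alphaN_gt0 : 0 < alphaN) (alphaF_gt0 : 0 < alphaF).
Hypotheses (gamma_gt0 : 0 < gamma) (u_gt0 : 0 < u) (b_gt0 : 0 < b).
Hypothesis u_le : alphaN * u <= alphaF.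

Definition node (t : R) : R := (cos t + 1) * u / 2.

(** Minus the derivative in [y] of [exp_poly p b (A_ alphaN alphaF y / gamma)]: the density of the
    SINR of a gain whose tail is [exp_poly p b]. *)
Definition sinr_density (y : R) : R :=
  exp_poly (b *: p - p^`()) b (A_ alphaN alphaF y / gamma)
  * (alphaF / (alphaF - alphaN * y) ^+ 2 / gamma).

Lemma node_ge0 t : 0 <= node t.
Proof.
by rewrite /node divr_ge0// mulr_ge0 ?(ltW u_gt0)// -lerBlDr sub0r cos_geN1.
Qed.

Lemma node_le t : node t <= u.
Proof.
rewrite /node ler_pdivrMr// mulrC ler_pM2l//.
by rewrite -lerBrDr (le_trans (cos_le1 t))// lerBrDr.
Qed.

Lemma node_lt t : cos t < 1 -> node t < u.
Proof.
move=> ct; rewrite /node ltr_pdivrMr// mulrC ltr_pM2l//.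
by rewrite -ltrBrDr (lt_le_trans ct)// lerBrDr.
Qed.

Lemma node_nonincreasing s t : 0 <= s -> s <= t -> t <= pi -> node t <= node s.
Proof.
move=> s0; rewrite le_eqVlt => /predU1P[->//|st] tpi.
rewrite /node ler_pM2r// ler_pM2r// lerD2r ltW// ltr_cos// in_itv/=.
  by rewrite s0 (le_trans (ltW st)).
by rewrite (le_trans s0 (ltW st)).
Qed.

Lemma cos_lt1 (t : R) : 0 < t <= pi -> cos t < 1.
Proof.
move=> /andP[t0 tpi]; rewrite -[ltRHS]cos0 ltr_cos ?in_itv/= ?lexx ?pi_ge0//.
by rewrite (ltW t0).
Qed.

Lemma sin_eq0_cos_ge1 (t : R) : 1 <= cos t -> sin t = 0.
Proof.
move=> ct; apply/eqP; rewrite -sqrf_eq0 sin2cos2.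
have -> : cos t = 1 by apply/le_anti; rewrite cos_le1.
by rewrite expr1n subrr.
Qed.

Lemma continuous_node : continuous node.
Proof.
move=> t; apply: cvgM; last exact: cvg_cst.
apply: cvgM; last exact: cvg_cst.
by apply: cvgD; [exact: continuous_cos|exact: cvg_cst].
Qed.

Lemma is_derive_node (t : R) : is_derive t 1 node (- (sin t * (u / 2))).
Proof. by apply: is_derive_eq; rewrite /GRing.scale /=; ring. Qed.

Lemma A_denominator_gt0 y : y < u -> 0 < alphaF - alphaN * y.
Proof.
move=> yu; rewrite subr_gt0 (lt_le_trans _ u_le)// ltr_pM2l//.
Qed.

Lemma A_ge0 y : 0 <= y < u -> 0 <= A_ alphaN alphaF y.
Proof.
by move=> /andP[y0 yu]; rewrite /A_ divr_ge0// ltW// A_denominator_gt0.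
Qed.

Lemma is_derive_A (y : R) : y < u ->
  is_derive y 1 (A_ alphaN alphaF) (alphaF / (alphaF - alphaN * y) ^+ 2).
Proof.
move=> yu; have d0 : alphaF - alphaN * y != 0.
  by rewrite gt_eqF// A_denominator_gt0.
have dd : is_derive y 1 (fun y : R => alphaF - alphaN * y) (- alphaN).
  by apply: is_derive_eq; rewrite /GRing.scale /=; ring.
have dM := is_deriveM (is_derive_id y 1)
  (is_deriveV (f := fun y : R => alphaF - alphaN * y) d0 dd).
by apply: (is_derive_eq dM); rewrite /GRing.scale /=; field.
Qed.

(** The minus sign of the decreasing map [node] cancels the one in [sinr_density]. Where [cos t < 1]
    the node lies below [u], so no denominator vanishes. *)
Lemma is_derive_tail (t : R) : cos t < 1 ->
  is_derive t 1 (fun t => exp_poly p b (A_ alphaN alphaF (node t) / gamma))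
    (sin t * (u / 2) * sinr_density (node t)).
Proof.
move=> ct.
have dA := is_derive1_comp (is_derive_A (node_lt ct)) (is_derive_node t).
have dz : is_derive t 1 (fun t => A_ alphaN alphaF (node t) / gamma)
    (alphaF / (alphaF - alphaN * node t) ^+ 2 * - (sin t * (u / 2)) / gamma).
  apply: is_derive_eq; rewrite /GRing.scale /=; ring.
have dF := is_derive1_comp (is_derive_exp_poly p b _) dz.
apply: (is_derive_eq dF).
rewrite /sinr_density -[b *: p - p^`()]opprB /exp_poly hornerN; ring.
Qed.

(* With z = A(y) / gamma, alphaF / (alphaF - alphaN y) = 1 + alphaN gamma z, so
   the density is a polynomial in z times exp(- b z). *)
Lemma sinr_density_bounded :
  exists2 M : R, 0 <= M & forall y, 0 <= y < u -> `|sinr_density y| <= M.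
Proof.
have [M M0 MP] := exp_poly_bounded
  ((b *: p - p^`()) * (1 + (alphaN * gamma) *: 'X) ^+ 2) b_gt0.
exists (M / (alphaF * gamma)); first by rewrite divr_ge0// mulr_ge0// ltW.
move=> y y01; have /andP[y0 yu] := y01.
have d0 := A_denominator_gt0 yu.
have z0 : 0 <= A_ alphaN alphaF y / gamma by rewrite divr_ge0 ?A_ge0// ltW.
rewrite ler_pdivlMr ?mulr_gt0//.
have aFg : 0 <= alphaF * gamma by rewrite ltW// mulr_gt0.
rewrite -(ger0_norm aFg).
rewrite -normrM (le_trans _ (MP _ z0))// le_eqVlt; apply/orP; left; apply/eqP.
congr `|_|.
rewrite /sinr_density /exp_poly hornerM horner_exp.
set D := horner (b *: p - p^`()) _; set E := expR _.
rewrite hornerD hornerZ hornerX hornerC /A_; field.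
by rewrite !gt_eqF.
Qed.

Lemma continuous_sinr_density y : y < u -> {for y, continuous sinr_density}.
Proof.
move=> yu; have d0 : alphaF - alphaN * y != 0.
  by rewrite gt_eqF// A_denominator_gt0.
have cA : {for y, continuous (A_ alphaN alphaF)}.
  apply: differentiable_continuous; apply/derivable1_diffP.
  by have [] := is_derive_A yu.
have cd : (alphaF - alphaN * y' @[y' --> y] --> alphaF - alphaN * y).
  apply: cvgB; first exact: cvg_cst.
  by apply: cvgM; [exact: cvg_cst|exact: cvg_id].
apply: cvgM.
  apply: (@continuous_comp _ _ _ (fun y => A_ alphaN alphaF y / gamma)
    (exp_poly (b *: p - p^`()) b)).
    by apply: cvgM; [exact: cA|exact: cvg_cst].
  exact: continuous_exp_poly.
apply: cvgM; last exact: cvg_cst.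
apply: cvgM; first exact: cvg_cst.
apply: cvgV; first by rewrite expf_neq0.
by apply: (@continuous_comp _ _ _ (fun y => alphaF - alphaN * y)
  (fun x => x ^+ 2)) => //; exact: exprn_continuous.
Qed.

(* The factor sin t cancels the junk value of the density where cos t = 1. *)
Lemma chebyshev_density_bounded :
  exists2 M : R, 0 <= M &
    forall t, `|sin t * (u / 2) * sinr_density (node t)| <= M * `|sin t|.
Proof.
have [M M0 MP] := sinr_density_bounded.
exists (u / 2 * M); first by rewrite mulr_ge0// divr_ge0// ltW.
move=> t; have : 0 <= u / 2 by rewrite divr_ge0// ltW.
move: (u / 2) => c c0; have [ct|ct] := ltP (cos t) 1.
  rewrite normrM (normrM (sin t)) (ger0_norm c0) -mulrA mulrC.
  by rewrite ler_wpM2r// ler_wpM2l//; apply: MP; rewrite node_ge0 node_lt.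
have st := sin_eq0_cos_ge1 ct.
by rewrite st !mul0r normr0 mulr0.
Qed.

(** Where [cos t = 1] the node is [u] and [alphaF - alphaN * u] may be 0, so composition fails;
    there [sin t] vanishes and the preceding bound squeezes the function to 0. *)
Lemma continuous_chebyshev_density :
  continuous (fun t => sin t * (u / 2) * sinr_density (node t)).
Proof.
move=> t; have [ct|ct] := ltP (cos t) 1.
  apply: cvgM.
    by apply: cvgM; [exact: continuous_sin|exact: cvg_cst].
  apply: (@continuous_comp _ _ _ node sinr_density).
    exact: continuous_node.
  exact/continuous_sinr_density/node_lt.
have st := sin_eq0_cos_ge1 ct.
have [M M0 MP] := chebyshev_density_bounded.
rewrite /continuous_at st !mul0r.
have cM : M * `|sin s| @[s --> t] --> 0.
  rewrite -(mulr0 M); apply: cvgM; first exact: cvg_cst.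
  have : `|sin s| @[s --> t] --> `|sin t|.
    apply: (@continuous_comp R R R sin (fun x => `|x|) t).
      exact: continuous_sin.
    exact: norm_continuous.
  by rewrite st normr0.
apply: (@squeeze_cvgr _ _ _ _ (fun s => - (M * `|sin s|))
  (fun s => M * `|sin s|)) => //.
  by near=> s; rewrite -ler_norml MP.
by have := cvgN cM; rewrite oppr0; apply.
Unshelve. all: by end_near.
Qed.

End chebyshev_parameter.

(** * Signal-to-interference-and-noise ratios and the secrecy event *)

Section sinr.
Context {R : realType}.
Variables (alphaN alphaF gamma : R).
Hypotheses (alphaN_gt0 : 0 < alphaN) (alphaF_gt0 : 0 < alphaF).
Hypothesis gamma_gt0 : 0 < gamma.

Let denominator_gt0 (x : R) : 0 <= x -> 0 < alphaN * gamma * x + 1.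
Proof. by move=> x0; rewrite ltr_wpDl// mulr_ge0// mulr_ge0// ltW. Qed.

Lemma sinr_ge0 (x : R) : 0 <= x -> 0 <= sinr_xF alphaN alphaF gamma x.
Proof.
move=> x0; rewrite /sinr_xF divr_ge0 ?(ltW (denominator_gt0 _))//.
by rewrite !mulr_ge0// ltW.
Qed.

Lemma sinr_lt_sup (x : R) : 0 <= x ->
  alphaN * sinr_xF alphaN alphaF gamma x < alphaF.
Proof.
move=> x0; rewrite /sinr_xF mulrA ltr_pdivrMr ?denominator_gt0//.
rewrite mulrDr mulr1.
rewrite (_ : alphaN * _ = alphaF * (alphaN * gamma * x)); last ring.
by rewrite ltrDl.
Qed.

(** [A_ / gamma] inverts the SINR as a function of the gain: below alphaF / alphaN the denominators
    are positive, and cross-multiplication leaves the same difference on both sides. *)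
Lemma sinr_le (x y : R) : 0 <= x -> alphaN * y < alphaF ->
  (sinr_xF alphaN alphaF gamma x <= y) = (x <= A_ alphaN alphaF y / gamma).
Proof.
move=> x0 yF; have d0 : 0 < alphaF - alphaN * y by rewrite subr_gt0.
rewrite /sinr_xF /A_ ler_pdivrMr ?denominator_gt0//.
rewrite ler_pdivlMr// ler_pdivlMr//.
rewrite -subr_ge0 -[RHS]subr_ge0; congr (0 <= _); ring.
Qed.

Lemma sinr_lt (x y : R) : 0 <= x -> alphaN * y < alphaF ->
  (y < sinr_xF alphaN alphaF gamma x) = (A_ alphaN alphaF y / gamma < x).
Proof. by move=> x0 yF; rewrite !ltNge sinr_le. Qed.

Lemma sinr_nondecreasing (x x' : R) : 0 <= x -> x <= x' ->
  sinr_xF alphaN alphaF gamma x <= sinr_xF alphaN alphaF gamma x'.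
Proof.
move=> x0 xx'; have x'0 := le_trans x0 xx'.
rewrite sinr_le// ?sinr_lt_sup// (le_trans xx')// -sinr_le// sinr_lt_sup//.
Qed.

Lemma A_nondecreasing (y y' : R) : y <= y' -> alphaN * y' < alphaF ->
  A_ alphaN alphaF y <= A_ alphaN alphaF y'.
Proof.
move=> yy' y'F; have d' : 0 < alphaF - alphaN * y' by rewrite subr_gt0.
have d : 0 < alphaF - alphaN * y.
  by rewrite subr_gt0 (le_lt_trans _ y'F)// ler_pM2l.
rewrite /A_ ler_pdivrMr// mulrAC ler_pdivlMr// -subr_ge0.
rewrite (_ : _ - _ = alphaF * (y' - y)); last ring.
by rewrite mulr_ge0 ?subr_ge0// ltW.
Qed.

Lemma measurable_sinr d (T : measurableType d) (f : T -> R) :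
  measurable_fun setT f -> (forall w, 0 <= f w) ->
  measurable_fun setT (fun w => sinr_xF alphaN alphaF gamma (f w)).
Proof.
move=> mf f0.
rewrite (_ : (fun w => _) = fun w => alphaF * gamma * f w *
    (alphaN * gamma * f w + 1) `^ (-1)); last first.
  by apply/funext => w; rewrite powR_inv1// ltW// denominator_gt0.
apply: measurable_realfun.measurable_funM.
  exact: measurable_realfun.measurable_funM.
apply: (measurableT_comp (measurable_realfun.measurable_powR _)).
apply: measurable_realfun.measurable_funD => //.
exact: measurable_realfun.measurable_funM.
Qed.

End sinr.

(** [1 + g_ r b] is 2^r (1 + b), so this is monotonicity of the logarithm. *)
Lemma log2_lt (R : realType) (a b r : R) : 0 <= a -> 0 <= b ->
  (log2 (1 + a) - log2 (1 + b) < r) = (a < g_ r b).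
Proof.
move=> a0 b0; have a1 : 0 < 1 + a by rewrite ltr_wpDr.
have b1 : 0 < 1 + b by rewrite ltr_wpDr.
have l2 : 0 < ln 2 :> R by rewrite ln_gt0// ltr1n.
have r2 : 0 < 2 `^ r :> R by rewrite powR_gt0.
rewrite /log2 -mulrBl ltr_pdivrMr// -ln_powR ltrBlDr -lnM ?posrE//.
rewrite ltr_ln ?posrE ?mulr_gt0//.
by rewrite /g_ -subr_gt0 -[RHS]subr_gt0; congr (0 < _); ring.
Qed.

(** * The probability of no outage as a Stieltjes integral *)

Section outage.
Context {R : realType} d (T : measurableType d) (P : probability T R).
Variables (W V : T -> R) (FX : R -> R) (p : {poly R}) (b : R).
Variables (alphaN alphaF gamma0 gammaE RsF : R).
Hypotheses (mW : measurable_fun setT W) (mV : measurable_fun setT V).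
Hypotheses (W_ge0 : forall w, 0 <= W w) (V_ge0 : forall w, 0 <= V w).
Hypothesis WV_indep : forall B C : set R, measurable B -> measurable C ->
  P ((W @^-1` B) `&` (V @^-1` C)) = (P (W @^-1` B) * P (V @^-1` C))%E.
Hypothesis W_cdf : forall x : R, 0 <= x -> P [set w | W w <= x] = (FX x)%:E.
Hypothesis V_cdf : forall x : R, 0 <= x ->
  P [set w | V w <= x] = (1 - exp_poly p b x)%:E.
Hypotheses (p0 : p.[0] = 1) (b_gt0 : 0 < b).
Hypotheses (alphaN_gt0 : 0 < alphaN) (alphaF_gt0 : 0 < alphaF).
Hypothesis alpha_sum : alphaF + alphaN = 1.
Hypotheses (gamma0_gt0 : 0 < gamma0) (gammaE_gt0 : 0 < gammaE).
Hypothesis RsF_ge0 : 0 <= RsF.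

Local Notation u := (u_ alphaN RsF).
Local Notation SF w := (sinr_xF alphaN alphaF gamma0 (W w)).
Local Notation SE w := (sinr_xF alphaN alphaF gammaE (V w)).

Hypothesis u_gt0 : 0 < u.

Definition secrecy_event : set T := [set w | g_ RsF (SE w) <= SF w].

Definition far_tail (t : R) : R :=
  1 - FX (A_ alphaN alphaF (g_ RsF (node u t)) / gamma0).

Let pr (A : set T) : R := fine (P A).

Let prE A : measurable A -> P A = (pr A)%:E.
Proof. by move=> mA; rewrite /pr fineK// fin_num_measure. Qed.

Let pr_le A B : measurable A -> measurable B -> A `<=` B -> pr A <= pr B.
Proof.
by move=> mA mB AB; rewrite fine_le ?fin_num_measure// le_measure ?inE.
Qed.

Let pr_ge0 A : 0 <= pr A. Proof. by rewrite fine_ge0. Qed.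

Let pr_le1 A : measurable A -> pr A <= 1.
Proof. by move=> mA; rewrite -lee_fin -prE// probability_le1. Qed.

Let pr_split A B : measurable A -> measurable B ->
  pr A = pr (A `\` B) + pr (A `&` B).
Proof.
move=> mA mB; rewrite /pr [in LHS](measureDI P mA mB) fineD//.
  by rewrite fin_num_measure//; exact: measurableD.
by rewrite fin_num_measure//; exact: measurableI.
Qed.

Let pow_ge1 : 1 <= 2 `^ RsF :> R.
Proof. by rewrite -[leLHS](powRr0 2) ler_powR// ler1n. Qed.

(* Both sides vanish at y = u: the threshold for the far user becomes infinite
   exactly at the end of the integration interval. *)
Lemma g_gap (y : R) : alphaF - alphaN * g_ RsF y = alphaN * 2 `^ RsF * (u - y).
Proof.
have r0 : 2 `^ RsF != 0 :> R by rewrite gt_eqF// powR_gt0.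
rewrite /g_ /u_ -[alphaF](addrK alphaN) alpha_sum; field.
by rewrite r0 gt_eqF.
Qed.

(** [alphaN * u] is 2^(-RsF) - alphaN. Equality occurs at [RsF = 0], and then the denominator of
    [A_] vanishes at [u]. *)
Lemma u_bound : alphaN * u <= alphaF.
Proof.
have r0 : 2 `^ RsF != 0 :> R by rewrite gt_eqF// powR_gt0.
rewrite /u_ mulrBr mulr1 lerBlDr alpha_sum div1r invfM mulrA divff ?gt_eqF//.
by rewrite mul1r invf_le1// powR_gt0.
Qed.

Let g_lt (y : R) : y < u -> alphaN * g_ RsF y < alphaF.
Proof.
by move=> yu; rewrite -subr_gt0 g_gap !mulr_gt0// ?subr_gt0// powR_gt0.
Qed.

Let y_lt (y : R) : y < u -> alphaN * y < alphaF.
Proof. by move=> yu; rewrite (lt_le_trans _ u_bound)// ltr_pM2l. Qed.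

Let g_mono (y y' : R) : (g_ RsF y <= g_ RsF y') = (y <= y').
Proof. by rewrite /g_ !lerD2r ler_pM2l// powR_gt0. Qed.

Let g_mono_lt (y y' : R) : (g_ RsF y < g_ RsF y') = (y < y').
Proof. by rewrite /g_ !ltrD2r ltr_pM2l// powR_gt0. Qed.

Let g_ge0 (y : R) : 0 <= y -> 0 <= g_ RsF y.
Proof.
by move=> y0; rewrite /g_ -addrA addr_ge0 ?subr_ge0// mulr_ge0// powR_ge0.
Qed.

(** Thresholds on the gains: for [t] in (0, pi], [c t < W] says that the far SINR exceeds
    [g_ RsF (node u t)], and [z t < V] that Eve's exceeds [node u t]. At [t = 0] the denominator in
    [c] is 0 and [c 0] is the default 0, so monotonicity is stated for positive parameters only. *)
Let c (t : R) := A_ alphaN alphaF (g_ RsF (node u t)) / gamma0.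
Let z (t : R) := A_ alphaN alphaF (node u t) / gammaE.

Let c_ge0 (t : R) : 0 <= c t.
Proof.
rewrite /c divr_ge0// ?(ltW gamma0_gt0)// /A_ divr_ge0//.
  by rewrite g_ge0// node_ge0.
by rewrite g_gap !mulr_ge0 ?subr_ge0 ?node_le ?powR_ge0// ltW.
Qed.

Let node_ltu (t : R) : 0 < t <= pi -> node u t < u.
Proof. by move=> t0; rewrite node_lt// cos_lt1. Qed.

Let z_ge0 (t : R) : 0 < t <= pi -> 0 <= z t.
Proof.
move=> t0; rewrite /z divr_ge0 ?(ltW gammaE_gt0)// /A_ divr_ge0 ?node_ge0//.
by rewrite subr_ge0 ltW// y_lt// node_ltu.
Qed.

Let z_le (s t : R) : 0 < s -> s <= t -> t <= pi -> z t <= z s.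
Proof.
move=> s0 st tpi; rewrite ler_pM2r ?invr_gt0// A_nondecreasing//.
  by rewrite node_nonincreasing// ltW.
by rewrite y_lt// node_ltu// s0 (le_trans st).
Qed.

Let c_le (s t : R) : 0 < s -> s <= t -> t <= pi -> c t <= c s.
Proof.
move=> s0 st tpi; rewrite ler_pM2r ?invr_gt0// A_nondecreasing//.
  by rewrite g_mono node_nonincreasing// ltW.
by rewrite g_lt// node_ltu// s0 (le_trans st).
Qed.

Let mWgt (x : R) : measurable [set w | x < W w].
Proof.
rewrite (_ : [set _ | _] = W @^-1` `]x, +oo[).
  by rewrite -[X in measurable X]setTI; exact: mW.
by apply/seteqP; split=> w /=; rewrite in_itv/= andbT.
Qed.

Let mVgt (x : R) : measurable [set w | x < V w].
Proof.
rewrite (_ : [set _ | _] = V @^-1` `]x, +oo[).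
  by rewrite -[X in measurable X]setTI; exact: mV.
by apply/seteqP; split=> w /=; rewrite in_itv/= andbT.
Qed.

Let W_tail (x : R) : 0 <= x -> pr [set w | x < W w] = 1 - FX x.
Proof.
move=> x0; have := probability_setC P (mWgt x).
rewrite (_ : ~` _ = [set w | W w <= x]).
  by rewrite W_cdf// prE// -EFinB => -[->]; rewrite opprB addrC subrK.
by apply/seteqP; split=> w /=; rewrite leNgt => /negP.
Qed.

Let V_tail (x : R) : 0 <= x -> pr [set w | x < V w] = exp_poly p b x.
Proof.
move=> x0; have := probability_setC P (mVgt x).
rewrite (_ : ~` _ = [set w | V w <= x]).
  by rewrite V_cdf// prE// -EFinB => -[] /addrI /oppr_inj.
by apply/seteqP; split=> w /=; rewrite leNgt => /negP.
Qed.

Lemma measurable_secrecy_event : measurable secrecy_event.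
Proof.
have mSF : measurable_fun setT (fun w => SF w) by exact: measurable_sinr.
have mSE : measurable_fun setT (fun w => SE w) by exact: measurable_sinr.
have mg : measurable_fun setT (fun w => g_ RsF (SE w)).
  apply: measurable_realfun.measurable_funB => //.
  apply: measurable_realfun.measurable_funD => //.
  exact: measurable_realfun.measurable_funM.
have := measurable_realfun.measurable_fun_ler mg mSF.
by move=> /(_ measurableT [set true] Logic.I); rewrite setTI.
Qed.

(** The running Stieltjes integral: it tends to 0 at 0 and reaches the whole probability of no
    outage at [pi]. *)
Let N (t : R) := pr (secrecy_event `&` [set w | z t < V w]).

Let slab (s t : R) := [set w | z t < V w] `\` [set w | z s < V w].

Let mslab (s t : R) : measurable (slab s t).
Proof. exact: measurableD. Qed.

Let slab_compl (s t : R) : 0 < s -> s <= t -> t <= pi ->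
  [set w | z t < V w] `&` [set w | z s < V w] = [set w | z s < V w].
Proof.
move=> s0 st tpi; apply/seteqP; split=> [w []//|w /= zs]; split=> //=.
by rewrite (le_lt_trans _ zs)// z_le.
Qed.

Let N_slab (s t : R) : 0 < s -> s <= t -> t <= pi ->
  N t - N s = pr (secrecy_event `&` slab s t).
Proof.
move=> s0 st tpi; have mE := measurable_secrecy_event.
have mI : measurable (secrecy_event `&` [set w | z t < V w]).
  exact: measurableI.
rewrite /N (pr_split mI (mVgt (z s))) -setIDA -setIA slab_compl//.
by rewrite addrK.
Qed.

Let slab_tail (s t : R) : 0 < s -> s <= t -> t <= pi ->
  pr (slab s t) = exp_poly p b (z t) - exp_poly p b (z s).
Proof.
move=> s0 st tpi.
rewrite -!V_tail ?z_ge0 ?s0 ?(lt_le_trans s0 st) ?(le_trans st)//.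
by rewrite (pr_split (mVgt (z t)) (mVgt (z s))) slab_compl// addrK.
Qed.

Let slab_indep (s t x : R) : 0 < s -> s <= t -> t <= pi -> 0 <= x ->
  pr (slab s t `&` [set w | x < W w]) =
  (exp_poly p b (z t) - exp_poly p b (z s)) * (1 - FX x).
Proof.
move=> s0 st tpi x0; rewrite -slab_tail// -W_tail// setIC.
have WE : [set w | x < W w] = W @^-1` `]x, +oo[%classic.
  by apply/seteqP; split=> w /=; rewrite in_itv/= andbT.
have VE : slab s t = V @^-1` (`]z t, +oo[ `\` `]z s, +oo[)%classic.
  by apply/seteqP; split=> w /=; rewrite !in_itv/= !andbT.
have mWV := WV_indep (measurable_itv `]x, +oo[)
  (measurableD (measurable_itv `]z t, +oo[) (measurable_itv `]z s, +oo[)).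
rewrite -WE -VE (prE (mWgt x)) (prE (mslab s t)) -EFinM in mWV.
by rewrite /pr mWV /= mulrC.
Qed.

Let V_node (t : R) (w : T) : 0 < t <= pi -> (z t < V w) = (node u t < SE w).
Proof. by move=> t0; rewrite -sinr_lt// y_lt// node_ltu. Qed.

Let W_node (t : R) (w : T) : 0 < t <= pi ->
  (c t < W w) = (g_ RsF (node u t) < SF w).
Proof. by move=> t0; rewrite -sinr_lt// g_lt// node_ltu. Qed.

(** On the slab Eve's SINR is at most [node u s], so a far SINR above [g_ RsF (node u s)] already
    excludes an outage. *)
Let N_ge (s t : R) : 0 < s -> s <= t -> t <= pi ->
  (exp_poly p b (z t) - exp_poly p b (z s)) * far_tail s <= N t - N s.
Proof.
move=> s0 st tpi; have s0pi : 0 < s <= pi by rewrite s0 (le_trans st).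
rewrite N_slab// -(slab_indep s0 st tpi (c_ge0 s)).
apply: pr_le => [||w [[zt zs] cs]].
- exact: measurableI.
- by apply: measurableI => //; exact: measurable_secrecy_event.
split=> //.
move/negP: zs cs; rewrite /= V_node// W_node// -leNgt => SEs SFs.
by rewrite /secrecy_event/= (le_trans _ (ltW SFs))// g_mono.
Qed.

(** On the slab Eve's SINR exceeds [node u t], so absence of outage forces a far SINR above
    [g_ RsF (node u t)]. *)
Let N_le (s t : R) : 0 < s -> s <= t -> t <= pi ->
  N t - N s <= (exp_poly p b (z t) - exp_poly p b (z s)) * far_tail t.
Proof.
move=> s0 st tpi; have t0pi : 0 < t <= pi by rewrite (lt_le_trans s0).
rewrite N_slab// -(slab_indep s0 st tpi (c_ge0 t)).
apply: pr_le => [||w [Ew [zt zs]]].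
- by apply: measurableI => //; exact: measurable_secrecy_event.
- exact: measurableI.
split=> //.
move: zt; rewrite /= V_node// W_node// => SEt.
by rewrite (lt_le_trans _ Ew)// g_mono_lt.
Qed.

Let N_le_tail (t : R) : 0 < t <= pi -> N t <= pr [set w | c t < W w].
Proof.
move=> t0; apply: pr_le => //.
  by apply: measurableI => //; exact: measurable_secrecy_event.
move=> w [Ew]; rewrite /= V_node// W_node// => SEt.
by rewrite (lt_le_trans _ Ew)// g_mono_lt.
Qed.

Let W_tail_small (e : R) : 0 < e ->
  exists2 x : R, 0 <= x & pr [set w | x < W w] < e.
Proof.
move=> e0.
have mfW : @isMeasurableFun d _ T R W by split.
pose WW : {RV P >-> R} := HB.pack W mfW.
have /fine_cvgP[_ /cvgrPdist_lt/(_ _ e0) [M [_ MP]]] := cvg_ccdfy0 WW.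
exists (Num.max 0 (M + 1)); first by rewrite le_max lexx.
have := MP (Num.max 0 (M + 1)).
rewrite sub0r normrN ger0_norm ?fine_ge0// => /(_ _)/=.
rewrite /ccdf /distribution /pushforward/=.
rewrite (_ : _ @^-1` _ = [set w | Num.max 0 (M + 1) < W w]).
  by apply; rewrite lt_max ltrDl ltr01 orbT.
by apply/seteqP; split=> w /=; rewrite in_itv/= andbT.
Qed.

(** The event in [N t] requires a far SINR above [g_ RsF (node u t)]. As [t] goes to 0 this level
    tends to [g_ RsF u], equal to alphaF / alphaN, which no finite gain reaches; hence [W] has to
    exceed any given [x]. *)
Let N_small : N t @[t --> 0^'+] --> 0.
Proof.
apply/cvgrPdist_lt => e e0.
have [x x0 xe] := W_tail_small e0.
have gx : sinr_xF alphaN alphaF gamma0 x < g_ RsF u.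
  rewrite -(ltr_pM2l alphaN_gt0).
  have /eqP := g_gap u; rewrite subrr mulr0 subr_eq0 => /eqP <-.
  exact: sinr_lt_sup.
have gc : g_ RsF (node u t) @[t --> (0:R)] --> g_ RsF (node u 0).
  apply: cvgB; last exact: cvg_cst.
  apply: cvgD; last exact: cvg_cst.
  by apply: cvgM; [exact: cvg_cst|exact: continuous_node].
have n0 : node u 0 = u by rewrite /node cos0; field.
rewrite n0 in gc.
have gcr := cvg_at_right_filter gc.
near=> t.
have t0 : 0 < t by near: t; exact: nbhs_right_gt.
have tpi : t <= pi by near: t; exact: nbhs_right_le (pi_gt0 R).
have gxt : sinr_xF alphaN alphaF gamma0 x < g_ RsF (node u t).
  by near: t; exact: (cvgr_gt _ gcr _ gx).
have t0pi : 0 < t <= pi by rewrite t0.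
rewrite sub0r normrN ger0_norm; last exact: pr_ge0.
rewrite (le_lt_trans (N_le_tail t0pi))// (le_lt_trans _ xe)//.
apply: pr_le => // w; rewrite /= W_node// => gt.
rewrite ltNge; apply/negP => Wx.
have := sinr_nondecreasing alphaN_gt0 alphaF_gt0 gamma0_gt0 (W_ge0 w) Wx.
rewrite leNgt => /negP; apply; exact: (lt_trans gxt).
Unshelve. all: by end_near.
Qed.

(** [z pi = 0], and [p.[0] = 1] says that [V] is positive almost surely, so the constraint on [V]
    removes a null set only. *)
Let N_pi : N pi = pr secrecy_event.
Proof.
have mE := measurable_secrecy_event.
have zpi : z pi = 0 by rewrite /z /node cospi addNr mul0r mul0r /A_ !mul0r.
rewrite (pr_split mE (mVgt (z pi))) -/(N pi) [X in X + _](_ : _ = 0) ?add0r//.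
apply/le_anti; rewrite pr_ge0 andbT.
have -> : 0 = 1 - pr [set w | z pi < V w].
  by rewrite V_tail zpi// /exp_poly p0 mulr0 oppr0 expR0 mulr1 subrr.
have := pr_split measurableT (mVgt (z pi)).
rewrite setTI {1}/pr probability_setT /= => ->; rewrite addrK.
by apply: pr_le; [exact: measurableD..|exact: setSD].
Qed.

Lemma far_tail01 (t : R) : 0 <= far_tail t <= 1.
Proof. by rewrite /far_tail -W_tail ?c_ge0// pr_ge0 pr_le1. Qed.

Lemma secrecy_probability_quadrature :
  pi / K%:R * (\sum_(1 <= i < K.+1)
    (sin ((2 * i%:R - 1) * pi / (2 * K%:R)) * (u / 2) *
     sinr_density alphaN alphaF gammaE b p
       (node u ((2 * i%:R - 1) * pi / (2 * K%:R)))) *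
    far_tail ((2 * i%:R - 1) * pi / (2 * K%:R)))
  @[K --> \oo] --> fine (P secrecy_event).
Proof.
rewrite -/(pr _) -N_pi.
apply: (@stieltjes_midpoint_cvg _ _ (fun t => exp_poly p b (z t)) N far_tail
  (fun t => sin t * (u / 2) *
    sinr_density alphaN alphaF gammaE b p (node u t))).
- exact: pi_gt0.
- exact: continuous_chebyshev_density u_bound.
- move=> t t0; apply: (is_derive_tail _ _ _ _ _ u_bound) => //.
  exact: cos_lt1.
- exact: far_tail01.
- move=> s t s0 st tpi; rewrite /far_tail -!W_tail ?c_ge0//.
  apply: pr_le => // w /=; apply: le_lt_trans; exact: c_le.
- exact: N_ge.
- exact: N_le.
- exact: N_small.
Qed.

End outage.

(** * The quadrature formula *)

Section quadrature_formula.
Context {R : realType}.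

(** The exponential series truncated after [a] terms; times exp(-b x) it is the tail of the gamma
    law with shape [a] and rate [b]. *)
Definition erlang_poly (a : nat) (b : R) : {poly R} :=
  \sum_(k < a) (b ^+ k / k`!%:R) *: 'X^k.

Lemma cdf_Z_bestE (a : nat) (m lambda x : R) : lambda != 0 ->
  cdf_Z_best a m lambda x =
  1 - exp_poly (erlang_poly a (m / lambda)) (m / lambda) x.
Proof.
move=> l0; rewrite /cdf_Z_best /exp_poly /erlang_poly horner_sum mulr_suml.
congr (1 - _); apply: eq_bigr => k _.
rewrite hornerZ hornerXn expr_div_n (mulrAC m).
by congr (_ * _ * _); rewrite invfM mulrA mulrAC.
Qed.

Lemma erlang_poly0 (a : nat) (b : R) : (0 < a)%N -> (erlang_poly a b).[0] = 1.
Proof.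
case: a => // a _; rewrite /erlang_poly horner_sum big_ord_recl big1.
  by rewrite hornerZ hornerXn !expr0 fact0 divr1 mulr1 addr0.
by move=> k _; rewrite hornerZ hornerXn expr0n/= mulr0.
Qed.

(** The sum would telescope to one monomial; it is kept term by term to match [h_FII]. At [k = 0]
    the factor [z ^+ k / z] is 1 / z, cancelled by [b * z], hence [z != 0]. *)
Lemma erlang_density (a : nat) (b z : R) : z != 0 ->
  (b *: erlang_poly a b - (erlang_poly a b)^`()).[z] =
  \sum_(k < a) b ^+ k / k`!%:R * (z ^+ k / z) * (b * z - k%:R).
Proof.
move=> z0; rewrite hornerD hornerN hornerZ /erlang_poly raddf_sum !horner_sum.
rewrite mulr_sumr -sumrB; apply: eq_bigr => k _ /=.
rewrite derivZ derivXn !hornerZ hornerMn !hornerXn -mulr_natr.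
move: (_ / _) => e; case: (k : nat) => [|n].
  by rewrite /= !expr0; field.
by rewrite /= exprS; move: (z ^+ n) => zn; field.
Qed.

Variables (LS aF aE : nat).
Variables (alphaN alphaF gamma0 gammaE RsF mF mE lambdaF lambdaE : R).
Hypotheses (alphaN_gt0 : 0 < alphaN) (alphaF_gt0 : 0 < alphaF).
Hypothesis alpha_sum : alphaF + alphaN = 1.
Hypotheses (gamma0_gt0 : 0 < gamma0) (gammaE_gt0 : 0 < gammaE).
Hypotheses (lambdaF_gt0 : 0 < lambdaF) (lambdaE_gt0 : 0 < lambdaE).
Hypothesis RsF_ge0 : 0 <= RsF.

Local Notation u := (u_ alphaN RsF).
Hypothesis u_gt0 : 0 < u.

Local Notation b := (mE / lambdaE).
Local Notation q t := (sin t * (u / 2) *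
  sinr_density alphaN alphaF gammaE b (erlang_poly aE b) (node u t)).
Local Notation psi := (far_tail (cdf_X_best LS aF mF lambdaF)
  alphaN alphaF gamma0 RsF).
Local Notation theta K i := ((2 * i%:R - 1) * pi / (2 * K%:R) : R).

Lemma theta_itv (K i : nat) : (0 < i <= K)%N -> 0 < theta K i < pi.
Proof.
move=> /andP[i0 iK]; have K0 : 0 < K%:R :> R by rewrite ltr0n (leq_trans i0).
have i1 : 1 <= i%:R :> R by rewrite ler1n.
have iK' : i%:R <= K%:R :> R by rewrite ler_nat.
have pi0 := pi_gt0 R.
apply/andP; split.
  by rewrite divr_gt0 ?mulr_gt0//; lra.
by rewrite ltr_pdivrMr ?mulr_gt0// mulrC ltr_pM2l//; lra.
Qed.

(** One summand of the formula factors into a summand of [cdf_X_best] at the threshold [c] and a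
    summand of Eve's density, with weight [pi / K] and Jacobian [sin t * (u / 2)]. *)
Lemma quadrature_term (p k K : nat) (delta : {ffun 'I_aF -> 'I_p.+1})
    (t y : R) : (0 < K)%N -> 0 < y -> alphaN * y < alphaF ->
  let c := A_ alphaN alphaF (g_ RsF y) / gamma0 in
  let z := A_ alphaN alphaF y / gammaE in
  pi * u * Phi LS mF lambdaF delta * alphaF * mE ^+ k * sin t
  / (k`!%:R * (2 * K%:R) * gamma0 ^+ varphi delta * gammaE ^+ k
     * lambdaE ^+ k)
  * h_FII alphaN alphaF gamma0 gammaE RsF mF mE lambdaF lambdaE
      p (varphi delta) k y =
  (Phi LS mF lambdaF delta * c ^+ varphi delta
    * expR (- (p%:R * mF * c / lambdaF)))
  * (pi / K%:R * (sin t * (u / 2) *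
      (b ^+ k / k`!%:R * (z ^+ k / z) * (b * z - k%:R) * expR (- (b * z))
       * (alphaF / (alphaF - alphaN * y) ^+ 2 / gammaE)))).
Proof.
move=> K0 y0 yF c z.
have K0' : K%:R != 0 :> R by rewrite pnatr_eq0 -lt0n.
have d0 : alphaF - alphaN * y != 0 by rewrite gt_eqF// subr_gt0.
have A0 : A_ alphaN alphaF y != 0.
  by rewrite /A_ mulf_neq0 ?invr_eq0// gt_eqF.
rewrite /h_FII expfzDr// -exprnP exprN1 expRD.
rewrite (_ : - (p%:R * mF * _ / _) = - (p%:R * mF * c / lambdaF)); last first.
  by rewrite /c; field; rewrite !gt_eqF.
rewrite (_ : - (mE * A_ alphaN alphaF y / _) = - (b * z)); last first.
  by rewrite /z; field; rewrite !gt_eqF.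
rewrite {}/c {}/z.
move: (A_ alphaN alphaF (g_ RsF y)) (A_ alphaN alphaF y) A0 => Ag A A0.
rewrite !expr_div_n.
have g0 : gamma0 ^+ varphi delta != 0 by rewrite expf_neq0// gt_eqF.
have gE : gammaE ^+ k != 0 by rewrite expf_neq0// gt_eqF.
have lE : lambdaE ^+ k != 0 by rewrite expf_neq0// gt_eqF.
have f0 : k`!%:R != 0 :> R by rewrite pnatr_eq0 -lt0n fact_gt0.
move: (alphaF - alphaN * y) d0 => D d0.
(* With exponentials, powers and the factorial made opaque, a rational identity remains. *)
move: (expR _) (expR _) (Phi _ _ _ _) => e1 e2 ph.
move: (gamma0 ^+ _) (gammaE ^+ _) (lambdaE ^+ _) (k`!%:R) g0 gE lE f0
  => g1 g2 l1 f1 g0 gE lE f0.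
move: (A ^+ k) (_ ^+ varphi delta) (mE ^+ k) => Ak Ap mk.
field.
by rewrite d0 A0 g0 gE lE f0 K0' !gt_eqF.
Qed.

Lemma SOP_FII_approxE (K : nat) : (0 < K)%N ->
  SOP_FII_approx LS aF aE alphaN alphaF gamma0 gammaE RsF mF mE lambdaF lambdaE
    K =
  1 - (pi / K%:R * (\sum_(1 <= i < K.+1) q (theta K i) * psi (theta K i))
       + pi / K%:R * (q (theta K 1) * psi (theta K 1))).
Proof.
move=> K0.
have K0' : K%:R != 0 :> R by rewrite pnatr_eq0 -lt0n.
pose F (i : nat) := \sum_(1 <= p < LS.+1) \sum_(delta in tuples aF p)
  \sum_(0 <= k < aE)
    Psi_FII LS alphaN alphaF gamma0 gammaE RsF mF mE lambdaF lambdaE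
      K delta k i
    * h_FII alphaN alphaF gamma0 gammaE RsF mF mE lambdaF lambdaE
        p (varphi delta) k ((v_ K i + 1) * u / 2).
(* The minus sign comes from [1 - FX], where the constant 1 of [cdf_X_best] cancels. *)
have FE (i : nat) : (0 < i <= K)%N ->
    F i = - (pi / K%:R * (q (theta K i) * psi (theta K i))).
  move=> iK; have /andP[t0 tpi] := theta_itv iK.
  have vE : v_ K i = cos (theta K i) by [].
  have sE : Num.sqrt (1 - v_ K i ^+ 2) = sin (theta K i).
    rewrite vE -sin2cos2 sqrtr_sqr ger0_norm// ltW// sin_gt0_pi// t0.
    by [].
  have yE : (v_ K i + 1) * u / 2 = node u (theta K i) by [].
  set t := theta K i in t0 tpi vE sE yE *.
  have ct : cos t < 1 by rewrite cos_lt1// t0 ltW.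
  (* Strictness keeps the node positive and [A_] nonzero, as the exponent -1 in [h_FII] requires. *)
  have ct1 : -1 < cos t.
    rewrite -cospi ltr_cos ?in_itv/= ?lexx ?pi_ge0//.
    by rewrite ltW// ltW.
  have y0 : 0 < node u t.
    by rewrite /node divr_gt0// mulr_gt0// -ltrBlDr sub0r.
  have yu : node u t < u by rewrite node_lt.
  have yF : alphaN * node u t < alphaF.
    rewrite (lt_le_trans _ (u_bound alphaN_gt0 alpha_sum RsF_ge0))//.
    by rewrite ltr_pM2l.
  have z0 : A_ alphaN alphaF (node u t) / gammaE != 0.
    have d0 : 0 < alphaF - alphaN * node u t by rewrite subr_gt0.
    by apply: lt0r_neq0; apply: divr_gt0 => //; exact: divr_gt0.
  rewrite /F /Psi_FII sE yE /sinr_density /exp_poly erlang_density//.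
  rewrite /far_tail /cdf_X_best opprD addrA subrr add0r.
  rewrite mulrN mulrN opprK [RHS]mulrA [RHS]mulr_sumr; apply: eq_bigr => p _.
  rewrite [RHS]mulr_sumr; apply: eq_bigr => delta _.
  rewrite [RHS]mulrC; do 2!rewrite [in RHS]mulr_suml.
  do 3!rewrite [in RHS]mulr_sumr.
  by rewrite big_mkord; apply: eq_bigr => k _; rewrite quadrature_term.
(* The angles of indices 0 and 1 are opposite, and the cosine is even. *)
have v01 : v_ K 0 = v_ K 1 :> R.
  by rewrite /v_ -cosN; congr cos; field.
have F01 : F 0%N = F 1%N by rewrite /F /Psi_FII v01.
have -> : SOP_FII_approx LS aF aE alphaN alphaF gamma0 gammaE RsF mF mE
    lambdaF lambdaE K = 1 + \sum_(0 <= i < K.+1) F i.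
  rewrite /SOP_FII_approx; congr (1 + _).
  rewrite [RHS]exchange_big/=; apply: eq_bigr => p _.
  rewrite [RHS]exchange_big/=; apply: eq_bigr => delta _.
  by rewrite exchange_big.
rewrite big_ltn// F01 FE// opprD; congr (1 + _).
rewrite [RHS]addrC; congr (_ + _); rewrite mulr_sumr -sumrN.
by rewrite big_nat [RHS]big_nat; apply: eq_bigr => i iK; exact: FE.
Qed.

Hypothesis b_gt0 : 0 < b.

(** Since [q] is bounded by a constant and [psi] by 1, a single term of the midpoint sum is O(1 /
    K). *)
Lemma first_node_vanishes : (forall t, 0 <= psi t <= 1) ->
  pi / K%:R * (q (theta K 1) * psi (theta K 1)) @[K --> \oo] --> 0.
Proof.
move=> psi01.
have [M M0 MP] := chebyshev_density_bounded (erlang_poly aE b) alphaN_gt0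
  alphaF_gt0 gammaE_gt0 u_gt0 b_gt0 (u_bound alphaN_gt0 alpha_sum RsF_ge0).
have bound K : `|pi / K%:R * (q (theta K 1) * psi (theta K 1))| <=
    (pi * M) * K%:R^-1.
  have K0 : 0 <= K%:R^-1 :> R by rewrite invr_ge0.
  have /andP[p0 p1] := psi01 (theta K 1).
  have pK : 0 <= pi / K%:R :> R by rewrite mulr_ge0// pi_ge0.
  have qM : `|q (theta K 1)| <= M.
    by rewrite (le_trans (MP _))// -[leRHS]mulr1 ler_wpM2l// sin_max.
  move: (q (theta K 1)) (psi (theta K 1)) qM p0 p1 => Q S qM p0 p1.
  rewrite normrM (ger0_norm pK) normrM (ger0_norm p0) [leRHS]mulrAC.
  by rewrite ler_wpM2l// -[leRHS]mulr1 ler_pM.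
have c0 : (pi * M) * K%:R^-1 @[K --> \oo] --> (0 : R).
  rewrite -(mulr0 (pi * M)); apply: cvgM; first exact: cvg_cst.
  apply/gtr0_cvgV0; last exact: cvgr_idn.
  by near=> K; rewrite ltr0n; near: K; exact: nbhs_infty_gt.
apply: (@squeeze_cvgr _ _ _ _ (fun K => - ((pi * M) * K%:R^-1))
  (fun K => (pi * M) * K%:R^-1)) => //.
  by near=> K; rewrite -ler_norml bound.
by have := cvgN c0; rewrite oppr0; apply.
Unshelve. all: by end_near.
Qed.

End quadrature_formula.

(** * Convergence of the approximation to the secrecy outage probability *)

Unset Implicit Arguments.
Set Strict Implicit.

Theorem theorem3
  (R : realType) (d : measure_display) (T : measurableType d)
  (P : probability T R)
  (* antennas, fading parameters, distances, path losses *)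
  (LS : nat) (LS_gt0 : (0 < LS)%N)
  (L : user -> nat) (L_gt0 : forall U, (0 < L U)%N)
  (m Omega dist theta : user -> R)
  (m_ge : forall U, 1 / 2 <= m U)
  (Omega_gt0 : forall U, 0 < Omega U)
  (dist_gt0 : forall U, 0 < dist U)
  (lambda : user -> R)
  (lambda_def : forall U, lambda U = Omega U / dist U `^ theta U)
  (aF aE : nat)
  (aFE : aF%:R = m Far * (L Far)%:R)
  (aEE : aE%:R = m Eve * (L Eve)%:R)
  (* channel coefficients *)
  (h : forall U : user, 'I_(L U) -> 'I_LS -> {RV P >-> (R * R)%type})
  (h_nakagami : forall (U : user) (j : 'I_(L U)) (i : 'I_LS),
     nakagami P (h U j i) (m U) (lambda U))
  (h_indep : mutually_independent P
     (fun k : {U : user & ('I_(L U) * 'I_LS)%type} =>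
        h (tag k) (tagged k).1 (tagged k).2 : T -> R * R))
  (* power allocation, transmit SNRs, secrecy rate threshold *)
  (alphaN alphaF gamma0 gammaE RsF : R)
  (alphaN_gt0 : 0 < alphaN) (alphaNF : alphaN < alphaF)
  (alpha_sum : alphaF + alphaN = 1)
  (gamma0_gt0 : 0 < gamma0) (gammaE_gt0 : 0 < gammaE)
  (RsF_ge0 : 0 <= RsF)
  (u_ge0 : 0 <= u_ alphaN RsF) :
  let X (i : 'I_LS) (w : T) := channel_gain (h Far) i w in
  let Z (i : 'I_LS) (w : T) := channel_gain (h Eve) i w in
  let ihat (w : T) := best_antenna LS_gt0 (fun i => X i w) in
  (forall x : R, 0 <= x ->
     P [set w | X (ihat w) w <= x] =
     (cdf_X_best LS aF (m Far) (lambda Far) x)%:E) ->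
  (forall x : R, 0 <= x ->
     P [set w | Z (ihat w) w <= x] =
     (cdf_Z_best aE (m Eve) (lambda Eve) x)%:E) ->
  let SOP := P [set w |
     log2 (1 + sinr_xF alphaN alphaF gamma0 (X (ihat w) w))
     - log2 (1 + sinr_xF alphaN alphaF gammaE (Z (ihat w) w)) < RsF] in
  SOP_FII_approx LS aF aE alphaN alphaF gamma0 gammaE RsF
    (m Far) (m Eve) (lambda Far) (lambda Eve) K @[K --> \oo] --> fine SOP.
Proof.
move=> X Z ihat X_cdf Z_cdf SOP.
have [mW mV WV_indep] := far_eve_independent LS_gt0 h_nakagami h_indep.
rewrite -/X -/Z -/ihat in mW mV WV_indep.
pose W w := X (ihat w) w; pose V w := Z (ihat w) w.
have W_ge0 w : 0 <= W w by apply: sumr_ge0 => j _; exact: sqr_ge0.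
have V_ge0 w : 0 <= V w by apply: sumr_ge0 => j _; exact: sqr_ge0.
have alphaF_gt0 : 0 < alphaF by exact: lt_trans alphaNF.
have lambda_gt0 U : 0 < lambda U by rewrite lambda_def divr_gt0// powR_gt0.
have m_gt0 U : 0 < m U by rewrite (lt_le_trans _ (m_ge U)).
(* At least one Erlang term is present, so Eve's tail starts at 1. *)
have aE_gt0 : (0 < aE)%N by rewrite -(ltr0n R) aEE mulr_gt0// ltr0n.
pose b := m Eve / lambda Eve.
have b_gt0 : 0 < b by rewrite divr_gt0.
pose E := secrecy_event W V alphaN alphaF gamma0 gammaE RsF.
have mE : measurable E by exact: measurable_secrecy_event.
have -> : fine SOP = 1 - fine (P E).
  have -> : SOP = P (~` E).
    congr (P _); apply/seteqP; split=> w /=; rewrite log2_lt.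
    - by rewrite ltNge => /negP.
    - exact: sinr_ge0 (W_ge0 w).
    - exact: sinr_ge0 (V_ge0 w).
    - by move/negP; rewrite -ltNge.
    - exact: sinr_ge0 (W_ge0 w).
    - exact: sinr_ge0 (V_ge0 w).
  by rewrite probability_setC// fineB// fin_num_measure.
(* For [u = 0] the quadrature weights vanish and the formula equals 1; the secrecy event is empty
   because [g_ RsF 0] is then alphaF / alphaN, which the far SINR never attains. *)
have [u0|u0] := eqVneq (u_ alphaN RsF) 0.
  have -> : E = set0.
    apply/seteqP; split=> // w.
    rewrite /E /secrecy_event /= leNgt => /negP; apply.
    have /eqP := g_gap RsF alphaN_gt0 alpha_sum 0.
    rewrite u0 subrr mulr0 subr_eq0 => /eqP gF.
    have := sinr_lt_sup alphaN_gt0 alphaF_gt0 gamma0_gt0 (W_ge0 w).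
    rewrite [ltRHS]gF ltr_pM2l// => /lt_le_trans; apply.
    rewrite /g_ !lerD2r ler_pM2l ?powR_gt0//.
    exact: sinr_ge0 (V_ge0 w).
  rewrite measure0 subr0 (_ : SOP_FII_approx _ _ _ _ _ _ _ _ _ _ _ _ = fun=> 1).
    exact: cvg_cst.
  apply/funext => K; rewrite /SOP_FII_approx big1 ?addr0// => p _.
  rewrite big1// => delta _; rewrite big1// => k _; rewrite big1// => i _.
  by rewrite /Psi_FII u0 mulr0 !mul0r.
have u_gt0 : 0 < u_ alphaN RsF by rewrite lt_def u0.
have V_cdf x : 0 <= x ->
    P [set w | V w <= x] = (1 - exp_poly (erlang_poly aE b) b x)%:E.
  by move=> x0; rewrite Z_cdf// cdf_Z_bestE// gt_eqF.
have tail01 : forall t, 0 <= far_tail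
    (cdf_X_best LS aF (m Far) (lambda Far)) alphaN alphaF gamma0 RsF t <= 1.
  exact: (far_tail01 mW X_cdf alphaN_gt0 alpha_sum gamma0_gt0 RsF_ge0 u_gt0).
have quad := secrecy_probability_quadrature mW mV W_ge0 V_ge0 WV_indep X_cdf
  V_cdf (erlang_poly0 b aE_gt0) b_gt0 alphaN_gt0 alphaF_gt0 alpha_sum gamma0_gt0
  gammaE_gt0 RsF_ge0 u_gt0.
have first := first_node_vanishes aE alphaN_gt0 alphaF_gt0 alpha_sum gammaE_gt0
  RsF_ge0 u_gt0 b_gt0 tail01.
have lim := cvgB (cvg_cst (1 : R)) (cvgD quad first).
rewrite addr0 in lim.
apply: cvg_trans (lim _ _ _); apply: near_eq_cvg; near=> K.
have K0 : (0 < K)%N by near: K; exact: nbhs_infty_gt.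
by rewrite SOP_FII_approxE.
Unshelve. all: by end_near.
Qed.
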